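(* Let $0<\alpha<1$ and $a,b,c\in\mathbb{R}$. If $c<0$, $b>0$, $a>-b$ and $\frac{-1}{4c}-b<a<\frac{-1}{4c}$, then there exists $$\tau_*=\frac{-\log\left(\frac{-1-4ac}{4bc}\right)}{\left(\frac{-1}{2c}\right)^{1/\alpha}}$$ such that for all $\tau>\tau_*$ the equation $D^{\alpha}x(t)+c\,D^{2\alpha}x(t)=a\,x(t)+b\,x(t-\tau)$ is unstable.
   Context: $D^{\mu}$ denotes the Caputo fractional derivative (base point $0$) in $t$: for $m\in\mathbb{N}$ and $m-1<\mu<m$, $D^{\mu}f(t)=\frac{1}{\Gamma(m-\mu)}\int_0^t (t-s)^{m-\mu-1}f^{(m)}(s)\,ds$, and $D^{m}f=f^{(m)}$. The equation is considered for $t>0$ with delay $\tau\ge 0$ and a prescribed history on $[-\tau,0]$ (together with a prescribed value $x'(0)$ when $1<2\alpha<2$). The characteristic equation is $\lambda^{\alpha}+c\lambda^{2\alpha}=a+b\,e^{-\lambda\tau}$ (principal branch of powers). For a given $\tau\ge 0$ the equation is called stable if all its solutions are bounded as $t\to\infty$, and unstable if it is not stable. The paper uses as its criterion that the existence of a positive real root $\lambda>0$ of the characteristic equation is sufficient for instability. *)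

(* Defs.v *)
From HB Require Import structures.
From mathcomp Require Import all_boot all_order all_algebra.
From mathcomp Require Import all_classical all_reals all_analysis.

Set Implicit Arguments.
Unset Strict Implicit.
Unset Printing Implicit Defensive.

Import Order.TTheory GRing.Theory Num.Theory.
Import numFieldNormedType.Exports.

Local Open Scope classical_set_scope.
Local Open Scope ring_scope.

Definition Gamma (R : realType) (z : R) : R :=
  \int[@lebesgue_measure R]_(s in `]0, +oo[) (s `^ (z - 1) * expR (- s)).

(** The end points are left out because, on a real function that also carries
    the history of a delay equation, [derive1] at [0] is a two-sided
    derivative.  Absolute continuity on the open interval already provides the
    absolutely continuous extension to [[u, v]]. *)
Definition abs_continuous_on (R : realType) (u v : R) (f : R -> R) : Prop :=
  forall e : R, 0 < e -> exists2 d : R, 0 < d &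
    forall (n : nat) (p q : 'I_n -> R),
      (forall i, [/\ u < p i, p i <= q i & q i < v]) ->
      trivIset [set: 'I_n] (fun i => `]p i, q i[%classic) ->
      \sum_(i < n) (q i - p i) < d ->
      \sum_(i < n) `|f (q i) - f (p i)| < e.

(** For [mu] not an integer, the [m] with [m - 1 < mu < m]. *)
Definition caputo_order (R : realType) (mu : R) : nat := (Num.truncn mu).+1.

(** [0 `^ r] is [0] for [r != 0], so the kernel is finite at the single point
    [s = t]. *)
Definition caputo_integrand (R : realType) (mu : R) (f : R -> R) (t s : R) : R :=
  let m := caputo_order mu in
  (t - s) `^ (m%:R - mu - 1) * derive1n m f s.

Definition caputo (R : realType) (mu : R) (f : R -> R) (t : R) : R :=
  if mu \is a Num.nat then derive1n (Num.truncn mu) f t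
  else (Gamma ((caputo_order mu)%:R - mu))^-1 *
       \int[@lebesgue_measure R]_(s in `[0, t]) caputo_integrand mu f t s.

(** Derivatives and integrals are total functions, so the existence of the
    Caputo derivative at [t > 0] is a separate condition: for [m - 1 < mu < m],
    [f^(m-1)] is absolutely continuous on [(0, t)], so that [f^(m)] exists
    almost everywhere there, and the defining integral converges. *)
Definition caputo_derivable (R : realType) (mu : R) (f : R -> R) (t : R) : Prop :=
  if mu \is a Num.nat then
    forall k : nat, (k < Num.truncn mu)%N ->
      forall s : R, 0 < s <= t -> derivable (derive1n k f) s 1
  else
    let m := caputo_order mu in
    [/\ forall k : nat, (k.+1 < m)%N ->
          forall s : R, 0 < s < t -> derivable (derive1n k f) s 1,
        abs_continuous_on 0 t (derive1n m.-1 f) &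
        (@lebesgue_measure R).-integrable `[0, t]
          (EFin \o caputo_integrand mu f t)].

(** [phi] is the history on [[-tau, 0]], [v] the value of [x'(0)], which is
    prescribed only when [1 < 2 alpha]; it is a right derivative since the
    history need not be differentiable. *)
Definition is_solution (R : realType) (alpha a b c tau : R)
    (phi : R -> R) (v : R) (x : R -> R) : Prop :=
  [/\ {within `[- tau, +oo[, continuous x},
      forall t : R, - tau <= t <= 0 -> x t = phi t,
      1 < 2 * alpha -> h^-1 * (x h - x 0) @[h --> 0^'+] --> v &
      forall t : R, 0 < t ->
        [/\ caputo_derivable alpha x t,
            caputo_derivable (2 * alpha) x t &
            caputo alpha x t + c * caputo (2 * alpha) x t
              = a * x t + b * x (t - tau)]].

Definition stable (R : realType) (alpha a b c tau : R) : Prop :=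
  forall (phi : R -> R) (v : R) (x : R -> R),
    is_solution alpha a b c tau phi v x ->
    bounded_near x (+oo%R : set_system R).

Definition unstable (R : realType) (alpha a b c tau : R) : Prop :=
  ~ stable alpha a b c tau.

(* Main.v *)
Require Import Defs.
From HB Require Import structures.
From mathcomp Require Import all_boot all_order all_algebra.
From mathcomp Require Import all_classical all_reals all_analysis.
From mathcomp Require Import measurable_realfun ring lra.
Import Order.TTheory GRing.Theory Num.Theory.
Import numFieldNormedType.Exports.
Local Open Scope classical_set_scope.
Local Open Scope ring_scope.

Set Implicit Arguments.
Unset Strict Implicit.
Unset Printing Implicit Defensive.

(** Write [kap p s = s `^ (p - 1) / Gamma p] on [0 < s]; these kernels satisfy
    [kap p * kap q = kap (p + q)] for the convolution, and [kap p] has Laplace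
    transform [l `^ (- p)].  If [x] vanishes with its first derivative at [0] and
    [U] is its second derivative, then the Caputo derivative of order [r < 2] of
    [x] is [kap (2 - r) * U], whatever the integer part of [r].

    Choose the history on [[- tau, 0]] as a [C^2] bump whose contribution
    [F t = b * phi (t - tau)] is nonnegative and supported in [[0, tau]].  The
    delay equation becomes the Volterra equation of the second kind
    [c U + kap alpha * U = kap (2 alpha) * (a U + b U(. - tau) + F'')], solved by
    a contraction in a norm weighted by an exponential, and [x = kap 2 * U].

    For [tau > tau_star] the characteristic equation has a root [l > 0].  If [x]
    were bounded, its Laplace transform at [l] would exist, and the transformed
    equation would read [0 = laplace F l], although [F >= 0] does not vanish. *)

(** * Affine changes of variables *)

Lemma measurable_fun_affine (R : realType) (c d : R) :
  measurable_fun setT (fun x : R => c * x + d).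
Proof. by apply: measurable_funD => //; exact: measurable_funM. Qed.

(** By uniqueness of Lebesgue measure it is enough to compare both sides on half-open intervals. For
    [c < 0] the preimage is closed on the other side, which leaves its length unchanged. *)
Lemma lebesgue_measure_affine (R : realType) (c d : R) (A : set R) :
  c != 0 -> measurable A ->
  (@lebesgue_measure R A =
   `|c|%:E * @lebesgue_measure R ((fun x => (c * x + d)%R) @^-1` A))%E.
Proof.
move=> c0 mA.
pose phi : R -> measurableTypeR R := fun x => c * x + d.
have mphi : measurable_fun setT phi by exact: measurable_fun_affine.
have c1 : 0 <= `|c| by [].
rewrite (_ : (_ * _)%E = mscale (NngNum c1) (pushforward (@lebesgue_measure R) phi) A)//.
apply: (@lebesgue_measure_unique R) => // X [[p q]/= pq <-].
rewrite /mscale/= /pushforward.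
have [c_gt0|c_lt0|c00] := ltgtP 0 c; last by rewrite -c00 eqxx in c0.
- have -> : phi @^-1` `]p, q] = `](p - d) / c, (q - d) / c]%classic.
    apply/seteqP; split=> x /=; rewrite !in_itv/= ltr_pdivrMr// ler_pdivlMr//;
      by rewrite ltrBlDr lerBrDr mulrC.
  rewrite [in RHS]lebesgue_measure_itv [LHS]lebesgue_measure_itv/= !lte_fin gtr0_norm//.
  rewrite ltr_pM2r ?invr_gt0// ltrD2r; case: ifPn => _; last by rewrite mule0.
  by rewrite -!EFinB -EFinM -mulrBl mulrCA divff// mulr1; congr EFin; ring.
- have -> : phi @^-1` `]p, q] = `[(q - d) / c, (p - d) / c[%classic.
    apply/seteqP; split=> x /=; rewrite !in_itv/= ltr_ndivlMr// ler_ndivrMr// andbC;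
      by rewrite ltrBlDr lerBrDr mulrC.
  rewrite [in RHS]lebesgue_measure_itv [LHS]lebesgue_measure_itv/= !lte_fin ltr0_norm//.
  rewrite ltr_nM2r ?invr_lt0// ltrD2r; case: ifPn => _; last by rewrite mule0.
  by rewrite -!EFinB -EFinM -mulrBl mulNr mulrCA divff// mulr1; congr EFin; ring.
Qed.

Section affine_change_of_variables.
Context (R : realType).
Local Notation mu := (@lebesgue_measure R).
Local Open Scope ereal_scope.

Lemma ge0_integral_affine (c d : R) (f : R -> \bar R) : c != 0%R ->
  measurable_fun setT f -> (forall x, 0 <= f x) ->
  \int[mu]_x f x = `|c|%:E * \int[mu]_x f (c * x + d)%R.
Proof.
move=> c0 mf f0.
have mphi := @measurable_fun_affine R c d.
have c1 : (0 <= `|c|)%R by [].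
pose phi : R -> measurableTypeR R := fun x => (c * x + d)%R.
rewrite (eq_measure_integral (mscale (NngNum c1) (pushforward mu phi))); last first.
  by move=> A mA _; exact: (@lebesgue_measure_affine R c d A c0 mA).
by rewrite ge0_integral_mscale// ge0_integral_pushforward// preimage_setT.
Qed.

Lemma integral_reflect (d : R) (f : R -> \bar R) : measurable_fun setT f ->
  \int[mu]_x f (d - x)%R = \int[mu]_x f x.
Proof.
move=> mf.
have H (g : R -> \bar R) : measurable_fun setT g -> (forall x, 0 <= g x) ->
    \int[mu]_x g (d - x)%R = \int[mu]_x g x.
  move=> mg g0; rewrite [RHS](@ge0_integral_affine (-1) d)// ?oppr_eq0 ?oner_eq0//.
  by rewrite normrN normr1 mul1e; apply: eq_integral => x _; rewrite mulN1r addrC.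
(* The integral is the difference of the integrals of the positive and negative parts, and the
   nonnegative case applies to each. *)
have mp := measurable_funepos mf; have mn := measurable_funeneg mf.
have Hp := H _ mp (fun=> funepos_ge0 _ _).
have Hn := H _ mn (fun=> funeneg_ge0 _ _).
rewrite [LHS]integralE [RHS]integralE -Hp -Hn /comp.
congr (_ - _); apply: eq_integral => x _; by rewrite ?funeposE ?funenegE.
Qed.

Lemma integral_shift (d : R) (f : R -> \bar R) : measurable_fun setT f ->
  \int[mu]_x f (x - d)%R = \int[mu]_x f x.
Proof.
(* A shift is the composition of two reflections. *)
move=> mf; rewrite -[RHS](integral_reflect 0)//.
rewrite -[RHS](integral_reflect d).
  by apply: eq_integral => x _; congr f; ring.
by apply: measurableT_comp => //; exact: measurable_funB.
Qed.

Lemma Rintegral_reflect (d : R) (f : R -> R) : measurable_fun setT f ->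
  (\int[mu]_x f (d - x) = \int[mu]_x f x)%R.
Proof.
by move=> mf; congr fine; rewrite -[RHS](integral_reflect d)//; exact/measurable_EFinP.
Qed.

Lemma Rintegral_shift (d : R) (f : R -> R) : measurable_fun setT f ->
  (\int[mu]_x f (x - d) = \int[mu]_x f x)%R.
Proof.
by move=> mf; congr fine; rewrite -[RHS](integral_shift d)//; exact/measurable_EFinP.
Qed.

Lemma integrable_reflect (d : R) (f : R -> R) :
  mu.-integrable setT (EFin \o f) ->
  mu.-integrable setT (EFin \o (fun x => f (d - x)%R)).
Proof.
move=> /integrableP[mf foo]; apply/integrableP; split.
  apply: measurableT_comp => //; apply: measurableT_comp => //.
    exact/measurable_EFinP. exact: measurable_funB.
apply: le_lt_trans foo; rewrite -[leRHS](integral_reflect d)//.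
exact: measurableT_comp.
Qed.
End affine_change_of_variables.

(** * Gamma function and fractional kernels *)

Section gamma_kernels.
Context (R : realType).
Local Notation mu := (@lebesgue_measure R).
Implicit Types p q M s t : R.

Lemma is_derive_powR p s : 0 < s ->
  is_derive s 1 (fun x : R => x `^ p / p) (p * s `^ (p - 1) / p).
Proof.
move=> s0.
have H := is_derive1_powR p s0.
rewrite [X in is_derive _ _ X _](_ : _ = (fun x : R => x `^ p) * cst p^-1)//.
apply: is_derive_eq; rewrite scaler0 add0r; exact: mulrC.
Qed.

(** For [p < 1] the integrand is singular at 0. On [1/(n+1), 1] the primitive s^p / p bounds the
    integral by 1/p uniformly in [n], and monotone convergence passes to the limit. *)
Lemma integral_powR_lty p : 0 < p ->
  (\int[mu]_(s in `]0%R, 1%R]) (s `^ (p - 1))%:E < +oo)%E.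
Proof.
move=> p0.
pose F n := `[(n.+1%:R : R)^-1, 1]%classic.
have FE : \bigcup_n F n = `]0, 1]%classic.
  apply/seteqP; split => [x [n _]|x]; rewrite /F/= !in_itv/=.
    by move=> /andP[nx ->]; rewrite (lt_le_trans _ nx).
  move=> /andP[x0 x1]; exists (Num.truncn x^-1) => //=; rewrite in_itv/= x1 andbT.
  by rewrite invf_ple ?posrE//; apply/ltW/truncnS_gt.
have mf : measurable_fun setT (fun s : R => (s `^ (p - 1))%:E).
  by apply/measurable_EFinP; exact: measurable_powR.
have H : ((\int[mu]_(s in F i) (s `^ (p - 1))%:E) @[i --> \oo] -->
    \int[mu]_(s in `]0%R, 1%R]) (s `^ (p - 1))%:E)%E.
  rewrite -FE; apply: (@ge0_nondecreasing_set_cvg_integral _ (measurableTypeR R)).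
  - move=> m n mn; apply/subsetPset => x; rewrite /F/= !in_itv/= => /andP[h ->].
    by rewrite andbT (le_trans _ h)// lef_pV2 ?posrE// ler_nat.
  - by move=> i; exact: measurable_itv.
  - by move=> i; exact: measurable_funTS.
  - by move=> i x _; rewrite lee_fin powR_ge0.
apply: (@le_lt_trans _ _ (p^-1)%:E); last exact: ltry.
apply: (cvge_le _ H); near=> n.
have n1 : (n.+1%:R : R)^-1 < 1.
  rewrite invf_lt1// ltr1n ltnS; near: n; exact: nbhs_infty_gt.
have n0 : 0 < (n.+1%:R : R)^-1 by [].
have dF (x : R) : 0 < x -> is_derive x 1 (fun x : R => x `^ p / p) (x `^ (p - 1)).
  move=> x0; have := is_derive_powR p x0.
  by rewrite mulrAC divff ?mul1r// gt_eqF.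
have cF (x q : R) : 0 < x -> {for x, continuous (fun x : R => x `^ q)}.
  move=> x0; apply/differentiable_continuous/derivable1_diffP.
  by apply: derivable_powR; rewrite in_itv/= x0.
rewrite (@continuous_FTC2 _ _ (fun x : R => x `^ p / p))//.
- rewrite powR1 mul1r -EFinB lee_fin lerBlDr lerDl divr_ge0 ?powR_ge0// ltW//.
- apply: continuous_in_subspaceT => x; rewrite inE/= in_itv/= => /andP[nx _].
  by apply: cF; rewrite (lt_le_trans _ nx).
- split.
  + move=> x; rewrite in_itv/= => /andP[nx _].
    by have [] := dF x (lt_trans n0 nx).
  + apply: cvg_at_right_filter; apply: cvgMl; exact: cF.
  + apply: cvg_at_left_filter; apply: cvgMl; exact: cF.
- move=> x; rewrite in_itv/= => /andP[nx _].
  have := dF x (lt_trans n0 nx) => dFx.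
  by rewrite derive1E; exact: derive_val.
Unshelve. all: by end_near. Qed.
(** Cutting the power off at 0 turns integrals over the whole line into integrals over [0, t]. The
    explicit test also gives [pw 1] the value 0 at 0, where [powR] with exponent 0 would give 1. *)
Definition pw p s : R := if 0 < s then s `^ (p - 1) else 0.

Lemma pw_ge0 p s : 0 <= pw p s.
Proof. by rewrite /pw; case: ifP => // _; exact: powR_ge0. Qed.

Lemma pw_le0 p s : s <= 0 -> pw p s = 0.
Proof. by rewrite /pw leNgt => /negbTE ->. Qed.

Lemma measurable_pw p : measurable_fun setT (pw p).
Proof.
by apply: measurable_fun_ifT => //; exact: measurable_fun_ltr.
Qed.

Lemma powR_le_expR p : exists2 C, 0 <= C &
  forall s, 1 <= s -> s `^ (p - 1) <= C * expR (- (- s / 2)).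
Proof.
(* From ln s <= s/K + ln K, this [K] makes the coefficient |p - 1| / K of s at most 1/2. *)
pose K := 2 * (`|p - 1| + 1).
have K0 : 0 < K by rewrite mulr_gt0// ltr_wpDl.
exists (expR (`|p - 1| * ln K)) => [|s s1]; first exact: expR_ge0.
have s0 : 0 < s by rewrite (lt_le_trans _ s1).
rewrite /powR gt_eqF// -expRD ler_expR.
have lns : ln s <= s / K + ln K.
  rewrite -{1}(@divfK _ K _ s) ?gt_eqF// lnM ?posrE ?divr_gt0// lerD2r.
  have := @le_ln1Dx R (s / K - 1); rewrite addrCA subrr addr0 => h.
  have : -1 < s / K - 1 by rewrite ltrBrDr addNr divr_gt0.
  move=> /h /le_trans; apply; lra.
have lns0 : 0 <= ln s by exact: ln_ge0.
apply: (@le_trans _ _ (`|p - 1| * ln s)); first by rewrite ler_wpM2r// ler_norm.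
apply: (@le_trans _ _ (`|p - 1| * (s / K + ln K))); first exact: ler_wpM2l.
rewrite mulrDr addrC lerD2l mulNr opprK /K invfM mulrCA ler_wpM2l ?(ltW s0)//.
rewrite mulrCA ger_pMr ?invr_gt0// ler_pdivrMr ?ltr_wpDl//; lra.
Qed.

Lemma pw_expR_lty p : 0 < p ->
  (\int[mu]_s (pw p s * expR (- s))%:E < +oo)%E.
Proof.
move=> p0; have [C C0 hC] := powR_le_expR p.
pose g1 s := (s `^ (p - 1)) * \1_(`]0, 1]%classic : set R) s.
have mg1 : measurable_fun setT g1.
  by apply: measurable_funM => //; exact: measurable_powR.
have ep0 s : 0 <= exponential_pdf 2^-1 s by apply: exponential_pdf_ge0.
have me : measurable_fun setT (exponential_pdf (2^-1 : R)).
  exact: measurable_exponential_pdf.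
(* The majorant is the power itself on ]0, 1] plus a multiple of the exponential density of rate
   1/2; the factor 2 cancels the 1/2 in that density. *)
apply: (@le_lt_trans _ _ (\int[mu]_s ((g1 s)%:E + (2 * C)%:E * (exponential_pdf 2^-1 s)%:E))%E).
  apply: ge0_le_integral => //.
  - by move=> s _; rewrite lee_fin mulr_ge0 ?pw_ge0 ?expR_ge0.
  - apply/measurable_EFinP/measurable_funM; first exact: measurable_pw.
    by apply: measurableT_comp => //; exact: measurable_funN.
  - apply: emeasurable_funD; first exact/measurable_EFinP.
    by apply: measurable_funeM; exact/measurable_EFinP.
  - move=> s _; rewrite -EFinM -EFinD lee_fin /pw /g1.
    have i0 : 0 <= (\1_(`]0, 1]%classic : set R) s : R) by [].
    case: ltP => s0 /=.
      rewrite exponential_pdfE ?(ltW s0)//=.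
      have [s1|/ltW s1] := leP s 1.
        rewrite indicE mem_set /= ?in_itv/= ?s0 ?s1// mulr1.
        apply: (@le_trans _ _ (s `^ (p - 1))); last first.
          by rewrite lerDl !mulr_ge0 ?expR_ge0.
        by rewrite ler_piMr ?powR_ge0// -expR0 ler_expR oppr_le0 ltW.
      apply: (@le_trans _ _ (C * expR (- (- s / 2)) * expR (- s))).
        by rewrite ler_wpM2r ?expR_ge0 ?hC.
      rewrite ler_wpDl ?mulr_ge0 ?powR_ge0// -mulrA -expRD.
      rewrite (_ : - (- s / 2) - s = - 2^-1 * s); last by field.
      by rewrite (_ : 2 * C * _ = C * expR (- 2^-1 * s))//; field.
    by rewrite mul0r addr_ge0 ?mulr_ge0 ?powR_ge0.
rewrite ge0_integralD//=; last 4 first.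
- by move=> s _; rewrite lee_fin mulr_ge0 ?powR_ge0.
- exact/measurable_EFinP.
- by move=> s _; rewrite -EFinM lee_fin !mulr_ge0.
- by apply: measurable_funeM; exact/measurable_EFinP.
rewrite ge0_integralZl//=; last 3 first.
- exact/measurable_EFinP.
- by move=> s _; rewrite lee_fin.
- by rewrite lee_fin mulr_ge0.
rewrite integral_exponential_pdf// mule1; apply: lte_add_pinfty; last exact: ltry.
rewrite (le_lt_trans _ (integral_powR_lty p0))// [leRHS]integral_mkcond.
by rewrite epatch_indic le_eqVlt; apply/orP; left; apply/eqP; apply: eq_integral.
Qed.

Lemma GammaE p : 0 < p ->
  (\int[mu]_s (pw p s * expR (- s))%:E = (Gamma p)%:E)%E.
Proof.
move=> p0; rewrite /Gamma Rintegral_mkcond.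
rewrite -[LHS]fineK; last first.
  rewrite ge0_fin_numE ?pw_expR_lty// integral_ge0// => s _.
  by rewrite lee_fin mulr_ge0 ?pw_ge0 ?expR_ge0.
congr (fine _)%:E; apply: eq_integral => s _; congr EFin.
rewrite patchE /pw; case: ltP => s0.
  by rewrite mem_set//= in_itv/= s0.
by rewrite mul0r memNset//= in_itv/= andbT; apply/negP; rewrite -leNgt.
Qed.

Lemma measurable_pw_expR p M : measurable_fun setT (fun s => pw p s * expR (- (M * s))).
Proof.
apply: measurable_funM; first exact: measurable_pw.
apply: measurableT_comp => //; apply: measurable_funN.
exact: measurable_funM.
Qed.

Lemma Gamma_gt0 p : 0 < p -> 0 < Gamma p.
Proof.
move=> p0; rewrite lt_def; apply/andP; split; last first.
  by rewrite Rintegral_ge0// => s _; rewrite mulr_ge0 ?powR_ge0 ?expR_ge0.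
apply/negP => /eqP G0; have := GammaE p0; rewrite G0 => I0.
(* This is a lower bound of the integrand on [1, 2], where 0 <= ln s <= 1 and s <= 2; the integral
   therefore cannot vanish. *)
pose c := expR (- `|p - 1| - 2).
have : (c%:E * mu `[1%R, 2%R] <= 0)%E.
  rewrite -[leRHS]I0 -integral_cst//.
  apply: (@le_trans _ _ (\int[mu]_(s in `[1%R, 2%R]) (pw p s * expR (- s))%:E)%E).
    apply: ge0_le_integral => //.
    - by move=> s _; rewrite lee_fin expR_ge0.
    - apply/measurable_EFinP/measurable_funTS; have := measurable_pw_expR p 1.
      by under eq_fun do rewrite mul1r.
    - move=> s; rewrite /= in_itv/= => /andP[s1 s2]; rewrite lee_fin.
      have s0 : 0 < s by rewrite (lt_le_trans _ s1).
      rewrite /pw s0 /powR gt_eqF// -expRD ler_expR.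
      have l0 : 0 <= ln s by exact: ln_ge0.
      have l1 : ln s <= 1.
        have := @le_ln1Dx R (s - 1); rewrite addrCA subrr addr0 => /(_ _)/le_trans; apply; lra.
      rewrite lerD ?lerN2//.
      have := ler_norm (- (p - 1)); rewrite normrN => h.
      have : 0 <= (`|p - 1| + (p - 1)) * ln s by rewrite mulr_ge0//; lra.
      have : 0 <= `|p - 1| * (1 - ln s) by rewrite mulr_ge0//; lra.
      lra.
  apply: ge0_subset_integral => //.
    apply/measurable_EFinP; have := measurable_pw_expR p 1.
    by under eq_fun do rewrite mul1r.
  by move=> s _; rewrite lee_fin mulr_ge0 ?pw_ge0 ?expR_ge0.
rewrite [X in (_ * X)%E]lebesgue_measure_itv/= lte_fin ltr1n/= -EFinB -EFinM lee_fin.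
by rewrite leNgt mulr_gt0 ?expR_gt0//; lra.
Qed.

Lemma laplace_pw p M : 0 < p -> 0 < M ->
  (\int[mu]_s (pw p s * expR (- (M * s)))%:E = (Gamma p * M `^ (- p))%:E)%E.
Proof.
move=> p0 M0.
rewrite (@ge0_integral_affine _ M^-1 0) ?invr_eq0 ?gt_eqF//; last 2 first.
  by apply/measurable_EFinP; exact: measurable_pw_expR.
  by move=> s; rewrite lee_fin mulr_ge0 ?pw_ge0 ?expR_ge0.
under eq_integral => s _.
  rewrite addr0 mulrA divff ?gt_eqF// mul1r /pw.
  rewrite pmulr_rgt0 ?invr_gt0//.
  rewrite (_ : (if _ then _ else _) = M `^ (1 - p) * pw p s); last first.
    rewrite /pw; case: ltP => s0; last by rewrite mulr0.
    rewrite powRM ?invr_ge0 ?(ltW M0) ?(ltW s0)//; congr (_ * _).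
    by rewrite -powR_inv1 ?(ltW M0)// -powRrM mulN1r opprB.
  rewrite -mulrA EFinM; over.
rewrite ge0_integralZl//; last 3 first.
- apply/measurable_EFinP; have := measurable_pw_expR p 1.
  by under eq_fun do rewrite mul1r.
- by move=> s _; rewrite lee_fin mulr_ge0 ?pw_ge0 ?expR_ge0.
- by rewrite lee_fin powR_ge0.
rewrite GammaE// -!EFinM; congr EFin.
rewrite gtr0_norm ?invr_gt0// mulrA mulrC; congr (_ * _).
rewrite -powR_inv1 ?(ltW M0)// -powRD; last by rewrite (gt_eqF M0) implybT.
by congr (_ `^ _); ring.
Qed.

End gamma_kernels.

(** * Convolution of power kernels *)

Section convolution.
Context (R : realType).
Local Notation mu := (@lebesgue_measure R).
Implicit Types p q M s t : R.

Lemma measurable_fun_prodM_shift (k f : R -> R) :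
  measurable_fun setT k -> measurable_fun setT f ->
  measurable_fun setT (fun z : measurableTypeR R * measurableTypeR R =>
    k z.1 * f (z.2 - z.1)).
Proof.
move=> mk mf; apply: measurable_funM.
  by apply: (measurableT_comp mk); exact: measurable_fst.
apply: (measurableT_comp mf).
by apply: measurable_funB; [exact: measurable_snd|exact: measurable_fst].
Qed.

(** Homogeneity: substituting t s for s extracts t^(p-1) and t^(q-1) from the factors, and one more
    t from the measure. *)
Lemma conv_pw_scale p q t : 0 < t ->
  (\int[mu]_s (pw p s * pw q (t - s))%:E =
   (t `^ (p + q - 1))%:E * \int[mu]_s (pw p s * pw q (1 - s))%:E)%E.
Proof.
move=> t0.
have mf u : measurable_fun setT (fun s => (pw p s * pw q (u - s))%:E).
  apply/measurable_EFinP/measurable_funM; first exact: measurable_pw.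
  apply: measurableT_comp; first exact: measurable_pw.
  exact: measurable_funB.
have f0 u s : (0 <= (pw p s * pw q (u - s))%:E)%E.
  by rewrite lee_fin mulr_ge0 ?pw_ge0.
have pwZ r s : pw r (t * s) = t `^ (r - 1) * pw r s.
  rewrite /pw pmulr_rgt0//; case: ltP => s0; last by rewrite mulr0.
  by rewrite powRM// ltW.
have tn0 : t != 0 by rewrite gt_eqF.
rewrite (ge0_integral_affine 0 tn0 (mf t) (f0 t)).
under eq_integral => s _.
  rewrite addr0 -{2}(mulr1 t) -mulrBr !pwZ mulrACA EFinM; over.
rewrite ge0_integralZl//; [|exact: mf|by rewrite lee_fin mulr_ge0 ?powR_ge0].
rewrite muleA -EFinM; congr (_%:E * _)%E.
rewrite gtr0_norm// -powRD; last by rewrite (gt_eqF t0) implybT.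
rewrite -{1}(powRr1 (ltW t0)) -powRD; last by rewrite (gt_eqF t0) implybT.
by congr (_ `^ _); ring.
Qed.

(** This is the Beta integral. Homogeneity leaves a single unknown constant [B], which Tonelli's
    theorem identifies. *)
Lemma conv_pw p q t : 0 < p -> 0 < q ->
  (\int[mu]_s (pw p s * pw q (t - s))%:E =
   (Gamma p * Gamma q / Gamma (p + q) * pw (p + q) t)%:E)%E.
Proof.
move=> p0 q0.
pose B := (\int[mu]_s (pw p s * pw q (1 - s))%:E)%E.
have convE u : (\int[mu]_s (pw p s * pw q (u - s))%:E = (pw (p + q) u)%:E * B)%E.
  have [u0|u0] := leP u 0.
    rewrite (pw_le0 _ u0) mul0e integral0_eq// => s _; congr EFin.
    have [s0|s0] := leP s 0; first by rewrite pw_le0// mul0r.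
    by rewrite (@pw_le0 _ _ (u - s)) ?mulr0//; lra.
  by rewrite conv_pw_scale// /pw u0.
have pq0 : 0 < p + q by rewrite addr_gt0.
(* Both sides are the Laplace transform at [1] of the convolution; this also
   shows that [B] is finite. *)
have BE : ((Gamma (p + q))%:E * B = (Gamma p * Gamma q)%:E)%E.
  rewrite -GammaE//.
  have mE r : measurable_fun setT (fun s => (pw r s * expR (- s))).
    have := @measurable_pw_expR _ r 1; by under eq_fun do rewrite mul1r.
  have E0 r s : 0 <= pw r s * expR (- s) by rewrite mulr_ge0 ?pw_ge0 ?expR_ge0.
  have B0 : (0 <= B)%E.
    by apply: integral_ge0 => s _; rewrite lee_fin mulr_ge0 ?pw_ge0.
  have mE2 r : measurable_fun setT (fun s => (pw r s * expR (- s))%:E).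
    by apply/measurable_EFinP; exact: mE.
  have mE2s r u : measurable_fun setT (fun s => (pw r (s - u) * expR (- (s - u)))%:E).
    by apply: (measurableT_comp (mE2 r)); exact: measurable_funB.
  have I0 r : (0 <= \int[mu]_s (pw r s * expR (- s))%:E)%E.
    by apply: integral_ge0 => s _; rewrite lee_fin.
  transitivity (\int[mu]_t \int[mu]_s ((pw p s * expR (- s)) *
                  (pw q (t - s) * expR (- (t - s))))%:E)%E.
    rewrite -ge0_integralZr//; [|exact: mE2|by move=> s _; rewrite lee_fin].
    apply: eq_integral => u _; rewrite EFinM muleAC -convE -ge0_integralZr//.
    - apply: eq_integral => s _; rewrite -EFinM; congr EFin.
      rewrite mulrACA -expRD; congr (_ * expR _); ring.
    - apply/measurable_EFinP/measurable_funM; first exact: measurable_pw.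
      apply: measurableT_comp; first exact: measurable_pw.
      exact: measurable_funB.
    - by move=> s _; rewrite lee_fin mulr_ge0 ?pw_ge0.
  rewrite -(fubini_tonelli (m1 := mu) (m2 := mu)
    (fun z => ((pw p z.1 * expR (- z.1)) *
      (pw q (z.2 - z.1) * expR (- (z.2 - z.1))))%:E))/=; last 2 first.
  - by apply/measurable_EFinP; apply: (measurable_fun_prodM_shift (mE p) (mE q)).
  - by move=> z; rewrite lee_fin mulr_ge0.
  rewrite EFinM -(GammaE p0) -(GammaE q0) -ge0_integralZr; last 4 first.
  - exact: measurableT.
  - exact: mE2.
  - by move=> s _; rewrite lee_fin.
  - exact: I0.
  apply: eq_integral => s _.
  under eq_integral => u _ do rewrite EFinM.
  rewrite ge0_integralZl; last 4 first.
  - exact: measurableT.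
  - exact: mE2s.
  - by move=> u _; rewrite lee_fin.
  - by rewrite lee_fin.
  by rewrite (integral_shift s (mE2 q)).
rewrite convE (_ : B = (Gamma p * Gamma q / Gamma (p + q))%:E).
  by rewrite -EFinM mulrC.
have Gn0 : Gamma (p + q) != 0 by rewrite gt_eqF// Gamma_gt0.
by rewrite -[LHS]mul1e -(mulVf Gn0) EFinM -muleA BE -EFinM mulrC.
Qed.
End convolution.

(** * Associativity of convolution *)

Section convolution_algebra.
Context (R : realType).
Local Notation mu := (@lebesgue_measure R).
Implicit Types (k l n f : R -> R) (p q M s t : R).

Definition conv k f t : R := \int[mu]_s (k s * f (t - s)).

Lemma measurable_fun_convM k f t : measurable_fun setT k -> measurable_fun setT f ->
  measurable_fun setT (fun s => k s * f (t - s)).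
Proof.
move=> mk mf; apply: measurable_funM => //.
by apply: (measurableT_comp mf); exact: measurable_funB.
Qed.

Lemma conv_reflect k f t : measurable_fun setT k -> measurable_fun setT f ->
  conv k f t = \int[mu]_s (k (t - s) * f s).
Proof.
move=> mk mf; rewrite /conv -(Rintegral_reflect t (measurable_fun_convM t mk mf)).
by apply: eq_Rintegral => s _; rewrite opprB addrCA subrr addr0.
Qed.

Lemma integrable_shift s (g : R -> \bar R) : mu.-integrable setT g ->
  mu.-integrable setT (fun r => g (r - s)).
Proof.
move=> /integrableP[mg goo]; apply/integrableP; split.
  by apply: (measurableT_comp mg); exact: measurable_funB.
rewrite (integral_shift s (f := fun r => `|g r|%E))//.
exact: measurableT_comp.
Qed.

(** Fubini's theorem. Since [k] and [l] are nonnegative, integrating the absolute value in the inner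
    variable first yields [n] times |f|, so the hypothesis on [n] gives integrability on the plane.
    Kernels are general because the Laplace product rule takes an exponential for [k]. *)
Lemma conv_conv k l n f t :
  measurable_fun setT k -> measurable_fun setT l -> measurable_fun setT n ->
  measurable_fun setT f ->
  (forall s, 0 <= k s) -> (forall s, 0 <= l s) ->
  (forall s, (\int[mu]_r (k r * l (s - r))%:E = (n s)%:E)%E) ->
  (forall u, mu.-integrable setT (EFin \o (fun s => l s * f (u - s)))) ->
  mu.-integrable setT (EFin \o (fun s => n s * f (t - s))) ->
  conv k (conv l f) t = conv n f t.
Proof.
move=> mk ml mn mf k0 l0 nE il In.
have n0 r : 0 <= n r.
  by rewrite -lee_fin -nE integral_ge0// => s _; rewrite lee_fin mulr_ge0.
have mkl u : measurable_fun setT (fun s => (k s * l (u - s))%:E).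
  by apply/measurable_EFinP; exact: measurable_fun_convM.
have ikl u : mu.-integrable setT (fun s => (k s * l (u - s))%:E).
  apply/integrableP; split; first exact: mkl.
  under eq_integral => s _ do rewrite gee0_abs ?lee_fin ?mulr_ge0//.
  by rewrite nE ltry.
pose F (z : measurableTypeR R * measurableTypeR R) :=
  ((k z.2 * l (z.1 - z.2)) * f (t - z.1))%:E.
have mF : measurable_fun setT F.
  apply/measurable_EFinP; apply: measurable_funM.
    apply: measurable_funM; first by apply: (measurableT_comp mk); exact: measurable_snd.
    apply: (measurableT_comp ml).
    by apply: measurable_funB; [exact: measurable_fst|exact: measurable_snd].
  apply: (measurableT_comp mf).
  by apply: measurable_funB => //; exact: measurable_fst.
have iF : (product_measure1 mu mu).-integrable setT F.
  apply/integrable12ltyP; first exact: mF.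
  move/integrableP : In => [mIn]; apply: le_lt_trans.
  rewrite le_eqVlt; apply/orP; left; apply/eqP; apply: eq_integral => r _.
  rewrite /F/=.
  under eq_integral => s _ do rewrite normrM EFinM ger0_norm ?mulr_ge0//.
  rewrite ge0_integralZr//; [|exact: mkl|by move=> s _; rewrite lee_fin mulr_ge0].
  by rewrite nE -EFinM normrM (ger0_norm (n0 r)).
rewrite /conv/Rintegral; congr fine; symmetry.
transitivity (\int[mu]_r \int[mu]_s F (r, s))%E.
  apply: eq_integral => r _; rewrite EFinM -nE -integralZr//; exact: ikl.
rewrite (Fubini iF).
apply: eq_integral => s _; rewrite /F/=.
under eq_integral => r _ do rewrite -mulrA EFinM.
have il' := il (t - s).
have ml' : measurable_fun setT (fun r => (l r * f (t - s - r))%:E).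
  exact: measurable_int il'.
have E : (\int[mu]_r (l (r - s) * f (t - r))%:E =
          \int[mu]_r (l r * f (t - s - r))%:E)%E.
  rewrite -(integral_shift s ml'); apply: eq_integral => r _.
  by congr (_ * f _)%:E; ring.
have iE : mu.-integrable setT (fun r => (l (r - s) * f (t - r))%:E).
  have -> : (fun r => (l (r - s) * f (t - r))%:E) =
            (fun r => (l (r - s) * f (t - s - (r - s)))%:E).
    by apply/funext => r; congr (_ * f _)%:E; ring.
  exact: (integrable_shift s il').
rewrite integralZl; [|exact: measurableT|exact: iE].
rewrite E EFinM; congr (_ * _)%E; rewrite fineK//.
exact: integrable_fin_num.
Qed.

End convolution_algebra.

(** * Fractional integrals and exponential growth *)

Section fractional_integral.
Context (R : realType).
Local Notation mu := (@lebesgue_measure R).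
Implicit Types (k l n f g : R -> R) (p q M s t B : R).

(** The Riemann-Liouville kernel: convolution with [kap p] is the fractional integral of order
    [p]. *)
Definition kap p s : R := pw p s / Gamma p.

Lemma kap_ge0 p s : 0 < p -> 0 <= kap p s.
Proof. by move=> p0; rewrite divr_ge0 ?pw_ge0// ltW ?Gamma_gt0. Qed.

Lemma kap_le0 p s : s <= 0 -> kap p s = 0.
Proof. by move=> s0; rewrite /kap pw_le0// mul0r. Qed.

Lemma measurable_kap p : measurable_fun setT (kap p).
Proof. by apply: measurable_funM => //; exact: measurable_pw. Qed.

Lemma laplace_kap p M : 0 < p -> 0 < M ->
  (\int[mu]_s (kap p s * expR (- (M * s)))%:E = (M `^ (- p))%:E)%E.
Proof.
move=> p0 M0; have G0 := Gamma_gt0 p0.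
under eq_integral => s _ do rewrite /kap mulrAC EFinM.
rewrite ge0_integralZr; last 4 first.
- exact: measurableT.
- by apply/measurable_EFinP; exact: measurable_pw_expR.
- by move=> s _; rewrite lee_fin mulr_ge0 ?pw_ge0 ?expR_ge0.
- by rewrite lee_fin invr_ge0 ltW.
by rewrite laplace_pw// -EFinM mulrAC divff ?mul1r// gt_eqF.
Qed.

Lemma integrable_kap_expR p M : 0 < p -> 0 < M ->
  mu.-integrable setT (EFin \o (fun s => kap p s * expR (- (M * s)))).
Proof.
move=> p0 M0; apply/integrableP; split.
  apply/measurable_EFinP; apply: measurable_funM; first exact: measurable_kap.
  apply: measurableT_comp => //; apply: measurable_funN.
  exact: measurable_funM.
apply: (@le_lt_trans _ _ (\int[mu]_s (kap p s * expR (- (M * s)))%:E)%E); last first.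
  by rewrite laplace_kap// ltry.
rewrite le_eqVlt; apply/orP; left; apply/eqP; apply: eq_integral => s _.
by rewrite /= ger0_norm// mulr_ge0 ?expR_ge0 ?kap_ge0.
Qed.

Lemma kap_convE p q t : 0 < p -> 0 < q ->
  (\int[mu]_s (kap p s * kap q (t - s))%:E = (kap (p + q) t)%:E)%E.
Proof.
move=> p0 q0.
under eq_integral => s _ do rewrite /kap mulrACA EFinM.
rewrite ge0_integralZr; last 4 first.
- exact: measurableT.
- apply/measurable_EFinP; exact: (measurable_fun_convM t (measurable_pw p) (measurable_pw q)).
- by move=> s _; rewrite lee_fin mulr_ge0 ?pw_ge0.
- by rewrite lee_fin mulr_ge0// invr_ge0 ltW ?Gamma_gt0.
rewrite conv_pw// -EFinM; congr EFin; rewrite /kap.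
have := lt0r_neq0 (Gamma_gt0 q0); have := lt0r_neq0 (Gamma_gt0 p0).
move: (Gamma p) (Gamma q) (Gamma (p + q)) (pw (p + q) t) => a b c d a0 b0.
by rewrite -invfM -(mulrA (a * b)) mulrAC mulfV ?mulf_neq0// mul1r mulrC.
Qed.

Section growth.
Variables (M B : R) (f : R -> R).
Hypotheses (M0 : 0 < M) (mf : measurable_fun setT f).
Hypothesis fB : forall t, `|f t| <= B * expR (M * t).

Let domE p t s : B * expR (M * t) * (kap p s * expR (- (M * s))) =
  kap p s * (B * expR (M * (t - s))).
Proof. by rewrite mulrBr expRD; ring. Qed.

Lemma integrable_kap_conv p t : 0 < p ->
  mu.-integrable setT (EFin \o (fun s => kap p s * f (t - s))).
Proof.
move=> p0.
apply: (@le_integrable _ _ _ mu setT measurableT _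
  (EFin \o (fun s => B * expR (M * t) * (kap p s * expR (- (M * s)))))) => //.
- by apply/measurable_EFinP; exact: (measurable_fun_convM t (measurable_kap p) mf).
- move=> s _; rewrite /= lee_fin domE normrM (ger0_norm (kap_ge0 s p0)) normrM.
  rewrite (ger0_norm (kap_ge0 s p0)); apply: ler_wpM2l; first exact: kap_ge0.
  by apply: le_trans (fB _) _; exact: ler_norm.
- exact: (integrableZl measurableT _ (integrable_kap_expR p0 M0)).
Qed.

(** In the norm sup |f t| exp(-M t), convolution with [kap p] has norm at most its Laplace transform
    M^(-p) at [M]. This tends to 0 as [M] grows, which is the source of the contraction. *)
Lemma conv_kap_bound p t : 0 < p ->
  `|conv (kap p) f t| <= M `^ (- p) * B * expR (M * t).
Proof.
move=> p0; have iE := integrable_kap_expR p0 M0.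
apply: (le_trans (le_normr_Rintegral measurableT (integrable_kap_conv t p0))).
apply: (@le_trans _ _ (\int[mu]_s (B * expR (M * t) * (kap p s * expR (- (M * s)))))).
  apply: le_Rintegral => //.
  - have /integrable_norm := integrable_kap_conv t p0; exact.
  - exact: (integrableZl measurableT _ iE).
  - move=> s _; rewrite domE normrM (ger0_norm (kap_ge0 s p0)).
    by apply: ler_wpM2l => //; exact: kap_ge0.
rewrite RintegralZl// /Rintegral laplace_kap//=.
by rewrite le_eqVlt; apply/orP; left; apply/eqP; ring.
Qed.

Lemma conv_kap_kap p q t : 0 < p -> 0 < q ->
  conv (kap p) (conv (kap q) f) t = conv (kap (p + q)) f t.
Proof.
move=> p0 q0; apply: conv_conv => //; try exact: measurable_kap.
- by move=> s; exact: kap_ge0.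
- by move=> s; exact: kap_ge0.
- by move=> s; exact: kap_convE.
- by move=> u; exact: integrable_kap_conv.
- by apply: integrable_kap_conv; rewrite addr_gt0.
Qed.

End growth.
End fractional_integral.

(** * Causal functions of exponential growth *)

Section causal_functions.
Context (R : realType).
Local Notation mu := (@lebesgue_measure R).
Implicit Types (f g : R -> R) (p q M s t B : R).

(** The class in which the Volterra equation is solved. The rate [M] is kept as a parameter: the
    contraction asks for a large [M], whereas the Laplace transform at [L] asks for [M < L]. *)
Definition causal M f : Prop :=
  [/\ continuous f, forall t, t <= 0 -> f t = 0 &
      exists B, forall t, `|f t| <= B * expR (M * t)].

Lemma causal_measurable M f : causal M f -> measurable_fun setT f.
Proof. by case=> cf _ _; exact: continuous_measurable_fun. Qed.

Lemma causalD M f g : causal M f -> causal M g -> causal M (fun t => f t + g t).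
Proof.
move=> [cf f0 [B fB]] [cg g0 [C gC]]; split.
- by move=> t; apply: continuousD; [exact: cf|exact: cg].
- by move=> t t0; rewrite f0// g0// addr0.
- exists (B + C) => t; rewrite mulrDl; apply: (le_trans (ler_normD _ _)).
  by rewrite lerD.
Qed.

Lemma causalZ M a f : causal M f -> causal M (fun t => a * f t).
Proof.
move=> [cf f0 [B fB]]; split.
- by move=> t; apply: continuousM; [exact: cst_continuous|exact: cf].
- by move=> t t0; rewrite f0// mulr0.
- by exists (`|a| * B) => t; rewrite normrM -mulrA ler_wpM2l.
Qed.

Lemma causal_delay M f tau : 0 <= M -> 0 <= tau -> causal M f ->
  causal M (fun t => f (t - tau)).
Proof.
move=> M0 tau0 [cf f0 [B fB]]; split.
- move=> t; apply: (@continuous_comp _ _ _ (fun t => t - tau) f); last exact: cf.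
  by apply: continuousB; [exact: cvg_id|exact: cst_continuous].
- by move=> t t0; rewrite f0//; lra.
- exists B => t; apply: (le_trans (fB _)).
  (* The growth bound at time 0 forces the constant to be nonnegative. *)
  have B0 : 0 <= B by have := le_trans (normr_ge0 _) (fB 0); rewrite mulr0 expR0 mulr1.
  by rewrite ler_wpM2l// ler_expR ler_wpM2l//; lra.
Qed.

Lemma continuousZ_shift a f tau : continuous f ->
  continuous (fun t => a * f (t - tau)).
Proof.
move=> cf t; apply: continuousM; first exact: cst_continuous.
apply: (@continuous_comp _ _ _ (fun t => t - tau) f); last exact: cf.
by apply: continuousB; [exact: cvg_id|exact: cst_continuous].
Qed.

(** Dominated convergence on the window ]t - 1, t + 1[: there the growth bound on [f] at the right
    end gives a majorant independent of the point. *)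
Lemma continuous_conv_kap p M f : 0 < p -> 0 < M -> causal M f ->
  continuous (conv (kap p) f).
Proof.
move=> p0 M0 cf t; have mf := causal_measurable cf.
have [ctf f0 [B fB]] := cf.
have B0 : 0 <= B by have := le_trans (normr_ge0 _) (fB 0); rewrite mulr0 expR0 mulr1.
apply: (@continuity_under_integral R _ _ mu (fun t s => kap p s * f (t - s)) setT
  measurableT (t - 1) (t + 1) _ _
  (fun s => B * expR (M * (t + 1)) * (kap p s * expR (- (M * s))))).
- by move=> x _; exact: (integrable_kap_conv M0 mf fB).
- apply: aeW => s _ x _; exact: continuousZ_shift.
- exact: (integrableZl measurableT _ (integrable_kap_expR p0 M0)).
- move=> x; rewrite /= in_itv/= => /andP[_ x1]; apply: aeW => s _.
  rewrite normrM (ger0_norm (kap_ge0 s p0)) mulrCA; apply: ler_wpM2l.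
    exact: kap_ge0.
  apply: (le_trans (fB _)); rewrite -mulrA -expRD ler_wpM2l// ler_expR.
  rewrite -mulrBr ler_wpM2l// ?ltW//; lra.
- by rewrite inE/= in_itv/=; apply/andP; split; lra.
Qed.

Lemma causal_conv_kap p M f : 0 < p -> 0 < M -> causal M f ->
  causal M (conv (kap p) f).
Proof.
move=> p0 M0 cf; have mf := causal_measurable cf.
have [ctf f0 [B fB]] := cf; split.
- exact: (continuous_conv_kap p0 M0 cf).
- move=> t t0; rewrite /conv /Rintegral integral0_eq// => s _; congr EFin.
  have [s0|s0] := leP s 0; first by rewrite kap_le0// mul0r.
  by rewrite f0 ?mulr0//; lra.
- by exists (M `^ (- p) * B) => t; exact: (conv_kap_bound M0 mf fB).
Qed.

Lemma conv_kapD p M f g t : 0 < p -> 0 < M -> causal M f -> causal M g ->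
  conv (kap p) (fun t => f t + g t) t = conv (kap p) f t + conv (kap p) g t.
Proof.
move=> p0 M0 cf cg; have mf := causal_measurable cf; have mg := causal_measurable cg.
have [_ _ [B fB]] := cf; have [_ _ [C gC]] := cg.
rewrite /conv -RintegralD//.
- by apply: eq_Rintegral => s _; rewrite mulrDr.
- exact: (integrable_kap_conv M0 mf fB).
- exact: (integrable_kap_conv M0 mg gC).
Qed.

Lemma conv_kapZ p M f a t : 0 < p -> 0 < M -> causal M f ->
  conv (kap p) (fun t => a * f t) t = a * conv (kap p) f t.
Proof.
move=> p0 M0 cf; have mf := causal_measurable cf.
have [_ _ [B fB]] := cf.
rewrite /conv -RintegralZl//.
- by apply: eq_Rintegral => s _; rewrite mulrCA.
- exact: (integrable_kap_conv M0 mf fB).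
Qed.

Lemma conv_delay (k : R -> R) f tau t :
  conv k (fun t => f (t - tau)) t = conv k f (t - tau).
Proof. by apply: eq_Rintegral => s _; congr (_ * f _); ring. Qed.

Lemma conv_kap_kap_causal p q M f : 0 < p -> 0 < q -> 0 < M -> causal M f ->
  conv (kap p) (conv (kap q) f) = conv (kap (p + q)) f.
Proof.
move=> p0 q0 M0 cf; have mf := causal_measurable cf.
have [_ _ [B fB]] := cf.
by apply/funext => t; exact: (conv_kap_kap M0 mf fB).
Qed.

Lemma conv_kap_add p q r M f : p + q = r -> 0 < p -> 0 < q -> 0 < M -> causal M f ->
  conv (kap p) (conv (kap q) f) = conv (kap r) f.
Proof. by move=> <-; exact: conv_kap_kap_causal. Qed.

End causal_functions.

(** * The kernel of order one and the Laplace transform *)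

Section integer_kernel.
Context (R : realType).
Local Notation mu := (@lebesgue_measure R).
Implicit Types (f g : R -> R) (p q M s t B : R).

Lemma Gamma1 : Gamma (1 : R) = 1.
Proof.
rewrite /Gamma /Rintegral integral_itv_obnd_cbnd; last first.
  apply: measurable_funTS; apply/measurable_EFinP; apply: measurable_funM.
    exact: measurable_powR.
  by apply: measurableT_comp => //; exact: measurable_funN.
rewrite (_ : (\int[_]_(_ in _) _)%E = 1%E)//.
rewrite -(@integral_exponential_pdf R 1)// [LHS]integral_mkcond.
apply: eq_integral => s _; rewrite /exponential_pdf !patchE.
by case: ifP => // _; congr EFin; rewrite subrr powRr0 !mul1r mulN1r.
Qed.

Lemma kap1E s : kap 1 s = (0 < s)%R%:R :> R.
Proof.
rewrite /kap Gamma1 divr1 /pw subrr; case: ltP => s0 //; exact: powRr0.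
Qed.

(** The kernel [kap 1] is the Heaviside function. Integrating from minus infinity lets the
    fundamental theorem of calculus apply at every real point, 0 included. *)
Lemma conv_kap1 M f t : 0 < M -> causal M f ->
  mu.-integrable `]-oo, t] (EFin \o f) /\
  conv (kap 1) f t = \int[mu]_(s in `]-oo, t]) f s.
Proof.
move=> M0 cf; have mf := causal_measurable cf.
have [_ _ [B fB]] := cf.
(* The kernel vanishes at 0, so the half-line first comes out open; a larger endpoint, or the null
   end point, then closes it. *)
have E u s : kap 1 (u - s) * f s = (f \_ `]-oo, u[) s.
  rewrite kap1E patchE subr_gt0; case: ltP => us.
    by rewrite mul1r mem_set.
  by rewrite mul0r memNset//= in_itv/=; apply/negP; rewrite -leNgt.
have io u : mu.-integrable `]-oo, u[ (EFin \o f).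
  apply/integrable_mkcond; first exact: measurable_itv.
  have := integrable_reflect u (integrable_kap_conv M0 mf fB u (@ltr01 R)).
  rewrite restrict_EFin; apply: eq_integrable; first exact: measurableT.
  by move=> s _ /=; rewrite -E opprB addrCA subrr addr0.
split.
  apply: (integrableS _ _ _ (io (t + 1))) => //.
  by move=> s; rewrite /= !in_itv/= => /le_lt_trans; apply; rewrite ltrDl.
rewrite conv_reflect//; last exact: measurable_kap.
rewrite -Rintegral_itv_bndo_bndc// [RHS]Rintegral_mkcond.
by apply: eq_Rintegral => s _; rewrite E.
Qed.

Lemma is_derive_conv_kap1 M f t : 0 < M -> causal M f ->
  is_derive t 1 (conv (kap 1) f) (f t).
Proof.
move=> M0 cf; have [ctf _ _] := cf.
have t1 : t < t + 1 by rewrite ltrDl.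
have [i1 _] := conv_kap1 (t + 1) M0 cf.
have -> : conv (kap 1) f = fun x => \int[mu]_(s in `]-oo, x]) f s.
  by apply/funext => x; have [_ ->] := conv_kap1 x M0 cf.
have [||d1 d2] := @continuous_FTC1 R f -oo%O t (t + 1) t1 i1.
- exact: ltNyr.
- exact: ctf.
by apply: DeriveDef; [exact: d1|rewrite -derive1E; exact: d2].
Qed.

(** The difference of the two sides has zero derivative and vanishes at 0. *)
Lemma causal_primitive M f g : 0 < M -> causal M g ->
  (forall t, is_derive t 1 f (g t)) -> f 0 = 0 -> f = conv (kap 1) g.
Proof.
move=> M0 cg df f0; apply/funext => t; apply/eqP; rewrite -subr_eq0; apply/eqP.
pose h := f \- conv (kap 1) g.
have dh (x : R) : is_derive x 1 h 0.
  have d1 := df x; have d2 := is_derive_conv_kap1 x M0 cg.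
  by apply: is_derive_eq; rewrite subrr.
rewrite -[LHS]/(h t) (is_derive_0_is_cst t 0 dh) /h/= f0.
by have [_ -> //] := causal_conv_kap (@ltr01 R) M0 cg; rewrite subrr.
Qed.

(** Integration over the whole line gives the usual one-sided transform when [f] is causal. *)
Definition laplace (L : R) f : R := \int[mu]_s (expR (- (L * s)) * f s).

Lemma integrable_laplace L M f : M < L -> causal M f ->
  mu.-integrable setT (EFin \o (fun s => expR (- (L * s)) * f s)).
Proof.
move=> ML cf; have mf := causal_measurable cf.
have [_ f0 [B fB]] := cf.
have LM0 : 0 < L - M by rewrite subr_gt0.
apply: (@le_integrable _ _ _ mu setT measurableT _
  (EFin \o (fun s => B * (kap 1 s * expR (- ((L - M) * s)))))) => //.
- apply/measurable_EFinP; apply: measurable_funM => //.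
  apply: measurableT_comp => //; apply: measurable_funN.
  exact: measurable_funM.
- move=> s _; rewrite /= lee_fin normrM (ger0_norm (expR_ge0 _)) kap1E.
  case: ltP => s0; last by rewrite f0// normr0 mulr0 mul0r mulr0 normr0.
  rewrite mul1r (le_trans _ (ler_norm _))// mulrC.
  apply: (@le_trans _ _ (B * expR (M * s) * expR (- (L * s)))).
    by rewrite ler_wpM2r ?expR_ge0.
  rewrite -mulrA -expRD le_eqVlt; apply/orP; left; apply/eqP; congr (_ * expR _); ring.
- exact: (integrableZl measurableT _ (integrable_kap_expR (@ltr01 R) LM0)).
Qed.

(* [laplace L f] is the value at [0] of the convolution of [f] with the
   exponential [s |-> expR (L * s)], which [kap p] multiplies by [L `^ (- p)];
   so the product rule is an instance of associativity. *)
Lemma laplace_conv_kap p L M f : 0 < p -> 0 < M -> M < L -> causal M f ->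
  laplace L (conv (kap p) f) = L `^ (- p) * laplace L f.
Proof.
move=> p0 M0 ML cf; have L0 := lt_trans M0 ML.
have mf := causal_measurable cf.
have [_ f0 [B fB]] := cf.
pose E s := expR (L * s).
have mE : measurable_fun setT E.
  by apply: measurableT_comp => //; exact: measurable_funM.
have lapE g : measurable_fun setT g -> laplace L g = conv E g 0.
  move=> mg; rewrite /laplace -(Rintegral_reflect 0).
    by apply: eq_Rintegral => s _; rewrite !sub0r mulrN opprK.
  apply: measurable_funM => //; apply: measurableT_comp => //.
  by apply: measurable_funN; exact: measurable_funM.
have iE : mu.-integrable setT (EFin \o (fun s => E s * f (0 - s))).
  rewrite (_ : (fun _ => _) = fun s => expR (- (L * (0 - s))) * f (0 - s)).
    exact: (integrable_reflect 0 (integrable_laplace ML cf)).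
  by apply/funext => s; rewrite !sub0r mulrN opprK.
rewrite !lapE//; last exact: causal_measurable (causal_conv_kap p0 M0 cf).
rewrite (@conv_conv _ E (kap p) (fun s => L `^ (- p) * E s))//.
- rewrite /conv -RintegralZl//.
    by apply: eq_Rintegral => s _; rewrite mulrA.
- exact: measurable_kap.
- exact: measurable_funM.
- by move=> s; exact: expR_ge0.
- by move=> s; exact: kap_ge0.
- move=> s; rewrite -(integral_reflect s); last first.
    by apply/measurable_EFinP; exact: (measurable_fun_convM s mE (@measurable_kap R p)).
  under eq_integral => r _.
    rewrite opprB addrCA subrr addr0 /E mulrBr expRD -mulrA EFinM (mulrC _ (kap p r)); over.
  rewrite ge0_integralZl; last 4 first.
  - exact: measurableT.
  - exact: (measurable_int _ (integrable_kap_expR p0 L0)).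
  - by move=> r _; rewrite lee_fin mulr_ge0 ?kap_ge0 ?expR_ge0.
  - by rewrite lee_fin expR_ge0.
  by rewrite laplace_kap// -EFinM mulrC.
- by move=> u; exact: (integrable_kap_conv M0 mf fB).
- have := integrableZl measurableT (L `^ (- p)) iE.
  by apply: eq_integrable => // s _ /=; rewrite -EFinM mulrA.
Qed.

Lemma laplace_delay L M f tau : M < L -> causal M f ->
  laplace L (fun t => f (t - tau)) = expR (- (L * tau)) * laplace L f.
Proof.
move=> ML cf; rewrite /laplace -RintegralZl//; last exact: integrable_laplace cf.
rewrite -(@Rintegral_shift _ tau (fun s => expR (- (L * tau)) * _)).
  by apply: eq_Rintegral => s _; rewrite mulrA -expRD; congr (expR _ * _); ring.
apply: measurable_funM => //; apply/measurable_EFinP.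
exact: (measurable_int _ (integrable_laplace ML cf)).
Qed.

Lemma laplaceD L M f g : M < L -> causal M f -> causal M g ->
  laplace L (fun t => f t + g t) = laplace L f + laplace L g.
Proof.
move=> ML cf cg; rewrite /laplace -RintegralD//.
- by apply: eq_Rintegral => s _; rewrite mulrDr.
- exact: integrable_laplace cf.
- exact: integrable_laplace cg.
Qed.

Lemma laplaceZ L M a f : M < L -> causal M f ->
  laplace L (fun t => a * f t) = a * laplace L f.
Proof.
move=> ML cf; rewrite /laplace -RintegralZl//; last exact: integrable_laplace cf.
by apply: eq_Rintegral => s _; rewrite mulrCA.
Qed.

End integer_kernel.

(** * The delayed Volterra equation *)

Section causal_fixpoint.
Context (R : realType).
Implicit Types (f g h : R -> R) (M K t : R).

Lemma half_expr_small (x e : R) : 0 < e -> exists n, x * 2^-1 ^+ n < e.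
Proof.
move=> e0; have [x0|x0] := leP x 0.
  by exists 0%N; rewrite expr0 mulr1 (le_lt_trans x0).
have := @cvg_expr R 2^-1; rewrite ger0_norm// => /(_ _).
rewrite invf_lt1// ltr1n => /(_ isT) /cvgr0_norm_lt => /(_ (e / x)).
rewrite divr_gt0// => /(_ isT) [N _ HN]; exists N.
have := HN N (leqnn N); rewrite /= ger0_norm ?exprn_ge0//.
by rewrite ltr_pdivlMr// mulrC.
Qed.

Lemma le0_half_expr (x y : R) : (forall n, x <= y * 2^-1 ^+ n) -> x <= 0.
Proof.
move=> h; rewrite leNgt; apply/negP => x0.
by have [n] := half_expr_small y x0; rewrite ltNge h.
Qed.

(** Banach's fixed point theorem with ratio 1/2 for the norm sup |f t| exp(-M t), which is present
    only through the constants [K]. The iterates start from 0, and their pointwise limit is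
    continuous because the convergence is uniform on left half-lines. *)
Lemma causal_fixpoint M (Phi : (R -> R) -> R -> R) : 0 <= M ->
  (forall f, causal M f -> causal M (Phi f)) ->
  (forall f g K, causal M f -> causal M g ->
    (forall t, `|f t - g t| <= K * expR (M * t)) ->
    forall t, `|Phi f t - Phi g t| <= K / 2 * expR (M * t)) ->
  exists2 U, causal M U & Phi U = U.
Proof.
move=> M0 cPhi Phi_contr.
pose u n := iter n Phi (fun=> 0).
have cu n : causal M (u n).
  elim: n => [|n ih]; last exact: cPhi.
  split=> [t|//|]; first exact: cst_continuous.
  by exists 0 => t; rewrite /u/= normr0 mul0r.
have [K uK] : exists K, forall t, `|u 1%N t - u 0%N t| <= K * expR (M * t).
  by have [_ _ [K uK]] := cu 1%N; exists K => t; rewrite subr0.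
have du n t : `|u n.+1 t - u n t| <= K * 2^-1 ^+ n * expR (M * t).
  elim: n t => [|n ih] t; first by rewrite expr0 mulr1.
  by rewrite exprSr mulrA; exact: (Phi_contr _ _ _ (cu n.+1) (cu n) ih t).
(* The tail of the geometric series of the steps, from index [n] on. *)
pose r n t := 2 * K * 2^-1 ^+ n * expR (M * t).
have ru n t : r n t = K * 2^-1 ^+ n * expR (M * t) + r n.+1 t.
  by rewrite /r exprS; field.
have umn m n t : (n <= m)%N -> `|u m t - u n t| <= r n t - r m t.
  move=> /subnK <-; elim: (m - n)%N => [|j ih]; first by rewrite !subrr normr0.
  rewrite addSn; have := du (j + n)%N t; have := ru (j + n)%N t.
  have -> : u (j + n).+1 t - u n t = (u (j + n).+1 t - u (j + n) t) + (u (j + n) t - u n t).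
    by rewrite addrA subrK.
  have := ler_normD (u (j + n).+1 t - u (j + n) t) (u (j + n) t - u n t).
  lra.
(* [u n t - r n t] increases and [u n t + r n t] decreases with [n]. *)
pose A t := [set u n t - r n t | n in [set: nat]].
pose U t := sup (A t).
have K0 : 0 <= K.
  by have := le_trans (normr_ge0 _) (uK 0); rewrite mulr0 expR0 mulr1.
have r0 n t : 0 <= r n t by rewrite !mulr_ge0 ?expR_ge0 ?exprn_ge0.
have ub n t : ubound (A t) (u n t + r n t).
  move=> _ [m _ <-]; have := r0 n t; have := r0 m t.
  have [nm|/ltnW mn] := leqP n m.
    have := umn m n t nm; have := ler_norm (u m t - u n t); lra.
  have := umn n m t mn; have := ler_norm (u m t - u n t); rewrite distrC; lra.
have Uu n t : `|U t - u n t| <= r n t.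
  have h1 : U t <= u n t + r n t by apply: ge_sup; [exists (u 0%N t - r 0%N t), 0%N|exact: ub].
  have h2 : u n t - r n t <= U t.
    by apply: ub_le_sup; [exists (u n t + r n t); exact: ub|exists n].
  rewrite ler_norml; lra.
have cU : causal M U.
  split.
  - move=> t; apply/cvgrPdist_lt => e e0.
    have e3 : 0 < e / 3 by rewrite divr_gt0.
    have [n hn] := half_expr_small (2 * K * expR (M * (t + 1))) e3.
    have rs s : s <= t + 1 -> r n s < e / 3.
      move=> st; apply: le_lt_trans hn; rewrite /r mulrAC ler_wpM2r ?exprn_ge0//.
      by rewrite ler_wpM2l ?mulr_ge0// ler_expR ler_wpM2l.
    have [ctu _ _] := cu n.
    have /cvgrPdist_lt/(_ _ e3) cn := ctu t.
    near=> s.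
    have st : s <= t + 1.
      near: s; exists 1 => //= s /=; rewrite ltr_distlC => /andP[_ /ltW]; exact.
    have h : `|u n t - u n s| < e / 3 by near: s; exact: cn.
    have h1 := Uu n t; have h2 := Uu n s; have h3 := rs _ st.
    have h4 : r n t < e / 3 by apply: rs; lra.
    rewrite distrC in h2.
    have := ler_normD (U t - u n t) (u n t - u n s + (u n s - U s)).
    have := ler_normD (u n t - u n s) (u n s - U s).
    have -> : U t - u n t + (u n t - u n s + (u n s - U s)) = U t - U s by ring.
    lra.
  - move=> t t0; apply/eqP; rewrite -normr_le0.
    apply: (@le0_half_expr _ (2 * K * expR (M * t))) => n.
    have := Uu n t; have [_ z _] := cu n; rewrite z// subr0 => /le_trans; apply.
    by rewrite /r mulrAC.
  - exists (2 * K) => t; have := Uu 0%N t; rewrite /r expr0 mulr1.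
    by rewrite /u/= subr0.
exists U => //; apply/funext => t.
apply/eqP; rewrite -subr_eq0 -normr_le0.
apply: (@le0_half_expr _ (2 * K * expR (M * t))) => n.
have h1 := Phi_contr U (u n) (2 * K * 2^-1 ^+ n) cU (cu n) (Uu n) t.
have h2 := Uu n.+1 t; rewrite -[u n.+1]/(Phi (u n)) in h2.
have e1 : 2 * K * 2^-1 ^+ n / 2 * expR (M * t) = K * 2^-1 ^+ n * expR (M * t) by field.
have -> : 2 * K * expR (M * t) * 2^-1 ^+ n = r n t by rewrite /r mulrAC.
rewrite e1 in h1; rewrite distrC in h2.
have := ler_normD (Phi U t - Phi (u n) t) (Phi (u n) t - U t).
rewrite addrA subrK; have := ru n t; lra.
Unshelve. all: by end_near. Qed.
End causal_fixpoint.

(** * Existence by contraction in a weighted norm *)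

Section delayed_volterra.
Context (R : realType).
Implicit Types (f g h : R -> R) (M K t a b c tau : R).

Lemma powRN_small p e : 0 < p -> 0 < e ->
  exists2 M0 : R, 0 < M0 & forall M, M0 <= M -> M `^ (- p) <= e.
Proof.
move=> p0 e0; exists (e `^ (- p^-1)) => [|M]; first exact: powR_gt0.
move=> eM; have M0 : 0 < M by rewrite (lt_le_trans _ eM)// powR_gt0.
rewrite powRN -(invrK e) lef_pV2 ?posrE ?invr_gt0 ?powR_gt0//.
have := ge0_ler_powR (ltW p0) _ _ eM; rewrite !nnegrE => /(_ (powR_ge0 _ _) (ltW M0)).
by rewrite -powRrM mulNr mulVf ?lt0r_neq0// powR_inv1//; exact: ltW.
Qed.

(** Division by [c] gives a fixed point equation. The delay does not increase the weighted norm, so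
    the Lipschitz constant is at most (M^(-2 alpha) (|a| + |b|) + M^(-alpha)) / |c|, which is small
    for large [M]. *)
Lemma delayed_volterra_existence alpha a b c tau g :
  0 < alpha -> c != 0 -> 0 <= tau -> (forall M, 0 < M -> causal M g) ->
  exists2 M, 0 < M & exists2 U, causal M U &
    forall t, c * U t + conv (kap alpha) U t =
      conv (kap (2 * alpha)) (fun t => a * U t + b * U (t - tau) + g t) t.
Proof.
move=> alpha0 c0 tau0 cg.
have alpha20 : 0 < 2 * alpha by rewrite mulr_gt0.
(* Once both powers of [M] are at most 1/D, the ratio is at most 1/4, within the required 1/2. *)
pose D := 4 * (`|a| + `|b| + 1) / `|c|.
have nc0 : 0 < `|c| by rewrite normr_gt0.
have D0 : 0 < D by rewrite divr_gt0// mulr_gt0//; have := normr_ge0 a; have := normr_ge0 b; lra.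
have iD0 : 0 < D^-1 by rewrite invr_gt0.
have [M1 M10 HM1] := powRN_small alpha0 iD0.
have [M2 M20 HM2] := powRN_small alpha20 iD0.
pose M := Num.max M1 M2.
have M0 : 0 < M by rewrite lt_max M10.
have hM1 : M `^ (- alpha) <= D^-1 by apply: HM1; rewrite le_max lexx.
have hM2 : M `^ (- (2 * alpha)) <= D^-1 by apply: HM2; rewrite le_max lexx orbT.
have {}cg := cg _ M0.
pose rhs f t := a * f t + b * f (t - tau) + g t.
have crhs f : causal M f -> causal M (rhs f).
  move=> cf; apply: causalD => //; apply: causalD; first exact: causalZ.
  by apply: causalZ; apply: causal_delay => //; exact: ltW.
pose Phi f t := c^-1 * (conv (kap (2 * alpha)) (rhs f) t + -1 * conv (kap alpha) f t).
have [f cf|f h K cf ch fh t|U cU PhiU] := @causal_fixpoint R M Phi (ltW M0).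
- apply: causalZ; apply: causalD; first exact/causal_conv_kap/crhs.
  by apply: causalZ; exact: causal_conv_kap.
- have K0 : 0 <= K.
    by have := le_trans (normr_ge0 _) (fh 0); rewrite mulr0 expR0 mulr1.
  pose d t := f t + -1 * h t.
  have cd : causal M d by apply: causalD => //; exact: causalZ.
  have dK s : `|d s| <= K * expR (M * s) by rewrite /d mulN1r.
  pose d2 t := a * d t + b * d (t - tau).
  have cdel : causal M (fun t => d (t - tau)) by apply: causal_delay => //; exact: ltW.
  have cd2 : causal M d2 by apply: causalD; exact: causalZ.
  have d2K s : `|d2 s| <= (`|a| + `|b|) * K * expR (M * s).
    apply: (le_trans (ler_normD _ _)); rewrite !normrM !mulrDl.
    apply: lerD; first by rewrite -mulrA ler_wpM2l.
    rewrite -mulrA ler_wpM2l// (le_trans (dK _))// ler_wpM2l// ler_expR ler_wpM2l// ?(ltW M0)//; lra.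
  have E : Phi f t - Phi h t = c^-1 * (conv (kap (2 * alpha)) d2 t - conv (kap alpha) d t).
    have Er : rhs f = (fun s => rhs h s + d2 s).
      by apply/funext => s; rewrite /rhs /d2 /d; ring.
    rewrite /Phi Er.
    have e1 := conv_kapD t alpha20 M0 (crhs _ ch) cd2.
    have e2 := conv_kapD t alpha0 M0 cf (causalZ (-1) ch).
    have e3 := conv_kapZ (-1) t alpha0 M0 ch.
    have e4 : conv (kap alpha) d t = conv (kap alpha) f t + -1 * conv (kap alpha) h t.
      exact: etrans e2 (congr1 (fun z => conv (kap alpha) f t + z) e3).
    have lin (x y z w v u : R) : x = y + z -> u = w + -1 * v ->
        c^-1 * (x + -1 * w) - c^-1 * (y + -1 * v) = c^-1 * (z - u).
      by move=> -> ->; ring.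
    exact: lin e1 e4.
  rewrite E normrM normfV.
  have b1 := conv_kap_bound M0 (causal_measurable cd) dK t alpha0.
  have b2 := conv_kap_bound M0 (causal_measurable cd2) d2K t alpha20.
  rewrite ler_pdivrMl//.
  have KE0 : 0 <= K * expR (M * t) by rewrite mulr_ge0 ?expR_ge0.
  have b1' : `|conv (kap alpha) d t| <= D^-1 * (K * expR (M * t)).
    by apply: (le_trans b1); rewrite -mulrA ler_wpM2r.
  have b2' : `|conv (kap (2 * alpha)) d2 t| <= D^-1 * ((`|a| + `|b|) * (K * expR (M * t))).
    apply: (le_trans b2); rewrite -!mulrA ler_wpM2r// !mulr_ge0// ?expR_ge0//.
  apply: (le_trans (ler_normB _ _)).
  have h4 : D^-1 * ((`|a| + `|b| + 1) * (K * expR (M * t))) = `|c| * (K / 4 * expR (M * t)).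
    rewrite /D; have : `|a| + `|b| + 1 != 0.
      by rewrite gt_eqF//; have := normr_ge0 a; have := normr_ge0 b; lra.
    move: (`|a| + `|b| + 1) (lt0r_neq0 nc0) => S nc S0; field; by rewrite S0 nc.
  have : 0 <= `|c| * (K * expR (M * t)) by rewrite mulr_ge0.
  lra.
exists M => //; exists U => // t.
have /(congr1 (fun f => c * f t)) := PhiU.
rewrite /Phi mulrA divff// mul1r => <-; rewrite /rhs; ring.
Qed.
End delayed_volterra.

(** * The history *)

Section bump_function.
Context (R : realType).
Implicit Types (f g h : R -> R) (t x C : R).

(** A quadratic remainder makes the error of the difference quotient O(h). This handles the square
    of the positive part at 0, where the positive part itself has a corner. *)
Lemma is_derive_quadratic f t d C :
  (forall x, `|f x - f t - d * (x - t)| <= C * (x - t) ^+ 2) -> is_derive t 1 f d.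
Proof.
move=> fC.
have C0 : 0 <= C.
  have := le_trans (normr_ge0 _) (fC (t + 1)).
  by rewrite addrAC subrr add0r expr1n mulr1.
have H : h^-1 *: (f (h *: 1 + t) - f t) @[h --> 0^'] --> d.
  apply/cvgrPdist_le => e e0; near=> h.
  have h0 : h != 0 by near: h; exact: nbhs_dnbhs_neq.
  have := fC (h + t); rewrite addrK => {}fC.
  rewrite (_ : _ - _ = - h^-1 * (f (h + t) - f t - d * h)); last first.
    rewrite !scaler1 /GRing.scale/= -[X in X - _](mulKf h0); ring.
  rewrite normrM normrN normfV ler_pdivrMl ?normr_gt0//.
  apply: (le_trans fC); rewrite -real_normK ?num_real// expr2 mulrCA ler_wpM2l//.
  have he : `|h| <= e / (C + 1).
    by near: h; apply: dnbhs0_le; rewrite divr_gt0 ?ltr_wpDl.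
  apply: (le_trans (ler_wpM2l C0 he)).
  rewrite mulrCA ger_pMr// ler_pdivrMr ?ltr_wpDl//; lra.
apply: DeriveDef; first by apply/cvg_ex; exists d.
exact: cvg_lim.
Unshelve. all: by end_near. Qed.

Definition pos t : R := Num.max 0 t.

Lemma pos_ge0 t : 0 <= pos t.
Proof. by rewrite /pos le_max lexx. Qed.

Lemma pos_le0 t : t <= 0 -> pos t = 0.
Proof. by move=> t0; rewrite /pos max_l. Qed.

Lemma pos_gt0 t : 0 < t -> pos t = t.
Proof. by move=> t0; rewrite /pos max_r// ltW. Qed.

Lemma continuous_pos : continuous pos.
Proof. by move=> t; apply: continuous_max; [exact: cst_continuous|exact: cvg_id]. Qed.

Lemma is_derive_pos_sq t : is_derive t 1 (fun x => pos x ^+ 2) (2 * pos t).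
Proof.
apply: (@is_derive_quadratic _ _ _ 1) => x; rewrite mul1r /pos ler_norml !expr2.
have := sqr_ge0 x; have := sqr_ge0 t; have := sqr_ge0 (x - t); rewrite !expr2.
case: (leP 0 x) => x0; case: (leP 0 t) => t0; [|move/ltW in t0|move/ltW in x0|].
- by move=> *; apply/andP; split; lra.
- by have := mulr_ge0_le0 x0 t0; move=> *; apply/andP; split; lra.
- by have := mulr_le0_ge0 x0 t0; move=> *; apply/andP; split; lra.
- by move=> *; apply/andP; split; lra.
Qed.

(** The cube of the positive part, written so that the product rule needs only the derivative of the
    square. *)
Definition cube t : R := t * pos t ^+ 2.

Lemma is_derive_cube t : is_derive t 1 cube (3 * pos t ^+ 2).
Proof.
rewrite [cube](_ : _ = id * (fun x => pos x ^+ 2))//.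
have d1 : is_derive t 1 (@id R) 1 by exact: is_derive_id.
have d2 := is_derive_pos_sq t.
apply: (is_derive_eq (is_deriveM d1 d2)).
rewrite /GRing.scale/= mulr1; have [t0|t0] := leP t 0.
  by rewrite !pos_le0// expr2; ring.
by rewrite !pos_gt0//; ring.
Qed.

Lemma cubeE t : cube t = pos t ^+ 3.
Proof.
rewrite /cube; have [t0|t0] := leP t 0; first by rewrite !pos_le0// !expr2; ring.
by rewrite !pos_gt0// exprS.
Qed.

Lemma is_derive_reflect f tau t (d : R) : is_derive (tau - t) 1 f d ->
  is_derive t 1 (fun x => f (tau - x)) (- d).
Proof.
move=> df; have dg : is_derive t 1 (fun x : R => tau - x) (-1).
  have d1 : is_derive t 1 (cst tau : R -> R) 0 by exact: is_derive_cst.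
  have d2 : is_derive t 1 (@id R) 1 by exact: is_derive_id.
  by apply: (is_derive_eq (is_deriveB d1 d2)); rewrite sub0r.
by rewrite -mulrN1; exact: (@is_derive1_comp R f (fun x => tau - x) t d (-1) df dg).
Qed.

(** The bump is the product of the cubes of the positive parts of t and tau - t; third powers make
    it twice continuously differentiable at 0 and at [tau]. *)
Lemma bump_exists tau : 0 < tau -> exists F F1 F2 : R -> R,
  [/\ forall t, is_derive t 1 F (F1 t), forall t, is_derive t 1 F1 (F2 t),
      forall t, (t <= 0) || (tau <= t) -> [/\ F t = 0, F1 t = 0 & F2 t = 0] &
      [/\ forall t, 0 <= F t, 0 < F (tau / 2) & forall M, 0 < M -> causal M F2]].
Proof.
move=> tau0.
pose Q t := pos (tau - t).
have dP := is_derive_cube.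
have dQ t : is_derive t 1 (fun x => cube (tau - x)) (- (3 * Q t ^+ 2)).
  exact: is_derive_reflect (is_derive_cube _).
have dP2 t : is_derive t 1 (fun x => 3 * pos x ^+ 2) (6 * pos t).
  apply: (is_derive_eq (is_deriveZ 3 (is_derive_pos_sq t))).
  by rewrite /GRing.scale/=; ring.
have dQ2 t : is_derive t 1 (fun x => 3 * Q x ^+ 2) (- (6 * Q t)).
  exact: (is_derive_reflect (f := fun x => 3 * pos x ^+ 2) (dP2 _)).
pose F t := cube t * cube (tau - t).
pose F1 t := 3 * pos t ^+ 2 * cube (tau - t) - cube t * (3 * Q t ^+ 2).
pose F2 t := 6 * (pos t * Q t ^+ 3 + pos t ^+ 3 * Q t) - 18 * (pos t ^+ 2 * Q t ^+ 2).
have cQ : continuous Q.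
  move=> t; apply: (@continuous_comp _ _ _ (fun t => tau - t) pos).
    by apply: continuousB; [exact: cst_continuous|exact: cvg_id].
  exact: continuous_pos.
have Q0 t : tau <= t -> Q t = 0 by move=> h; rewrite /Q pos_le0// subr_le0.
have Qge t : 0 <= Q t by exact: pos_ge0.
exists F, F1, F2; split.
- move=> t; apply: (is_derive_eq (is_deriveM (dP t) (dQ t))).
  by rewrite /GRing.scale/= /F1; ring.
- move=> t; apply: (is_derive_eq (is_deriveB (is_deriveM (dP2 t) (dQ t))
    (is_deriveM (dP t) (dQ2 t)))).
  by rewrite /GRing.scale/= /F2 !cubeE -/(Q t); ring.
- move=> t /orP[t0|t0]; rewrite /F /F1 /F2 !cubeE -/(Q t).
    by rewrite pos_le0//; split; rewrite ?expr0n /=; ring.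
  by rewrite Q0//; split; rewrite ?expr0n /=; ring.
split.
- by move=> t; rewrite /F !cubeE mulr_ge0// exprn_ge0// pos_ge0.
- have t2 : 0 < tau / 2 by rewrite divr_gt0.
  have t3 : 0 < tau - tau / 2 by lra.
  by rewrite /F !cubeE !pos_gt0// mulr_gt0// exprn_gt0.
- move=> M M0; split.
  + have cM f g : continuous f -> continuous g -> continuous (fun t => f t * g t).
      by move=> cf cg t; exact: (continuousM (cf t) (cg t)).
    have cD f g : continuous f -> continuous g -> continuous (fun t => f t + g t).
      by move=> cf cg t; exact: (continuousD (cf t) (cg t)).
    have cB f g : continuous f -> continuous g -> continuous (fun t => f t - g t).
      by move=> cf cg t; exact: (continuousB (cf t) (cg t)).
    have cC k : continuous (fun _ : R => k : R) by move=> t; exact: cst_continuous.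
    have cX f n : continuous f -> continuous (fun t => f t ^+ n).
      move=> cf; elim: n => [|n ih]; first exact: cC.
      rewrite (_ : (fun _ => _) = fun t => f t * f t ^+ n); first exact: cM.
      by apply/funext => t; rewrite exprS.
    have cP := continuous_pos.
    exact: (cB _ _ (cM _ _ (cC 6) (cD _ _ (cM _ _ cP (cX _ 3%N cQ)) (cM _ _ (cX _ 3%N cP) cQ)))
      (cM _ _ (cC 18) (cM _ _ (cX _ 2%N cP) (cX _ 2%N cQ)))).
  + move=> t t0; rewrite /F2 pos_le0//; ring.
  (* The coefficients 6, 6 and 18 of [F2] add up to 30, and each monomial has degree 4 in factors
     bounded by [tau]. *)
  + exists (30 * tau ^+ 4) => t.
    have B0 : 0 <= 30 * tau ^+ 4 * expR (M * t).
      by rewrite !mulr_ge0 ?exprn_ge0 ?expR_ge0// ltW.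
    have [t0|t0] := leP t 0.
      rewrite /F2 pos_le0// (_ : _ - _ = 0) ?normr0//; ring.
    have [tt|tt] := leP tau t.
      rewrite /F2 Q0// (_ : _ - _ = 0) ?normr0//; ring.
    have pt : pos t <= tau by rewrite pos_gt0// ltW.
    have qt : Q t <= tau by rewrite /Q pos_gt0 ?subr_gt0//; lra.
    have mon i j : (i + j = 4)%N -> 0 <= pos t ^+ i * Q t ^+ j <= tau ^+ 4.
      move=> <-; rewrite exprD mulr_ge0 ?exprn_ge0 ?pos_ge0//=.
      by rewrite ler_pM ?exprn_ge0 ?pos_ge0// lerXn2r ?nnegrE ?pos_ge0// ltW.
    have := mon 1%N 3%N erefl; have := mon 2%N 2%N erefl; have := mon 3%N 1%N erefl.
    rewrite !expr1 => /andP[h1 h2] /andP[h3 h4] /andP[h5 h6].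
    apply: (@le_trans _ _ (30 * tau ^+ 4)).
      by rewrite /F2 ler_norml; lra.
    rewrite ler_peMr ?mulr_ge0 ?exprn_ge0 ?(ltW tau0)// -expR0 ler_expR.
    by rewrite mulr_ge0// ltW.
Qed.
End bump_function.

(** * Caputo derivatives and the delay equation *)

Section caputo_derivatives.
Context (R : realType).
Local Notation mu := (@lebesgue_measure R).
Implicit Types (f g X W : R -> R) (M t : R).

(** By the mean value theorem [f] is Lipschitz on the segment, with a constant [K] just above the
    maximum of |df|. *)
Lemma abs_continuous_on_C1 f df u v : u <= v ->
  (forall t, is_derive t 1 f (df t)) -> continuous df -> abs_continuous_on u v f.
Proof.
move=> uv fdf cdf e e0.
have [K K0 HK] : exists2 K : R, 0 < K & forall s, u <= s <= v -> `|df s| <= K.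
  have [|s _ hs] := @EVT_max R (fun s => `|df s|) u v uv.
    apply: continuous_subspaceT => s; apply: continuous_comp; first exact: cdf.
    exact: norm_continuous.
  exists (`|df s| + 1) => [|r ruv]; first by rewrite ltr_wpDl.
  by rewrite (le_trans (hs r _))// lerDl.
exists (e / K); first by rewrite divr_gt0.
move=> n p q pq _ sd.
apply: (@le_lt_trans _ _ (K * \sum_(i < n) (q i - p i))).
  rewrite mulr_sumr; apply: ler_sum => i _; have [up piq qv] := pq i.
  have cf : {within `[p i, q i], continuous f}.
    apply: continuous_subspaceT => s; apply: differentiable_continuous.
    by apply/derivable1_diffP; have [] := fdf s.
  have [c] := MVT_segment piq (fun s _ => fdf s) cf.
  rewrite in_itv/= => /andP[pc cq] ->; rewrite normrM (@ger0_norm _ (q i - p i)) ?subr_ge0//.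
  rewrite ler_wpM2r ?subr_ge0// HK//; lra.
by rewrite mulrC -ltr_pdivlMr.
Qed.

Lemma caputo_integrandE r X W M t s : r \isn't a Num.nat -> 0 <= r ->
  causal M W -> (forall s, 0 <= s -> derive1n (caputo_order r) X s = W s) ->
  (caputo_integrand r X t \_ `[0, t]) s =
    pw ((caputo_order r)%:R - r) (t - s) * W s.
Proof.
move=> nnat m0 [_ W0 _] XW; rewrite patchE /pw subr_gt0.
have [s0|s0] := ltP s 0.
  by rewrite W0 ?mulr0 ?ltW// memNset//= in_itv/=; apply/negP; rewrite leNgt s0.
have [st|ts] := ltP s t.
  by rewrite mem_set/= ?in_itv/= ?s0 ?(ltW st)// /caputo_integrand XW.
rewrite mul0r; have [tes|] := eqVneq s t; last first.
  move=> nst; rewrite memNset//= in_itv/= s0/=; apply/negP.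
  by rewrite leNgt lt_neqAle eq_sym nst ts.
(* At s = t the exponent is [truncn r - r], which is nonzero because [r] is not an integer; hence
   the power of 0 is 0 and agrees with [pw]. *)
rewrite tes /caputo_integrand subrr powR0 ?mul0r ?if_same//.
rewrite /caputo_order -addn1 natrD addrAC addrK subr_eq0.
by apply: contraNN nnat; rewrite natrEtruncn.
Qed.

(** The Caputo derivative sees the function on [0, t] only. So [X] may carry a history, while its
    derivative is replaced by the causal [W] that agrees with it from 0 on. *)
Lemma caputo_conv r X W M t : 0 < M -> r \isn't a Num.nat -> 0 <= r ->
  causal M W -> (forall s, 0 <= s -> derive1n (caputo_order r) X s = W s) ->
  mu.-integrable `[0, t] (EFin \o caputo_integrand r X t) /\
  caputo r X t = conv (kap ((caputo_order r)%:R - r)) W t.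
Proof.
move=> M0 nnat m0 cW XW; have mW := causal_measurable cW.
have [_ _ [B WB]] := cW.
set p := _ - r; have p0 : 0 < p.
  by rewrite subr_gt0; have /andP[] := truncn_itv m0.
have E s := caputo_integrandE t s nnat m0 cW XW.
have ik : mu.-integrable setT (EFin \o (fun s => kap p (t - s) * W s)).
  have := integrable_reflect t (integrable_kap_conv M0 mW WB t p0).
  by apply: eq_integrable => // s _ /=; rewrite opprB addrCA subrr addr0.
have iC : mu.-integrable setT (EFin \o (caputo_integrand r X t \_ `[0, t])).
  have := integrableZl measurableT (Gamma p) ik.
  apply: eq_integrable; first exact: measurableT.
  move=> s _ /=; rewrite E -EFinM; congr EFin.
  rewrite /kap mulrA mulrCA mulfV ?mulr1// lt0r_neq0//; exact: Gamma_gt0.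
split.
  by apply/integrable_mkcond; [exact: measurable_itv|rewrite restrict_EFin].
rewrite /caputo (negbTE nnat) Rintegral_mkcond conv_reflect//; last exact: measurable_kap.
rewrite -RintegralZl//.
by apply: eq_Rintegral => s _; rewrite E /kap mulrA; congr (_ * _); rewrite mulrC.
Qed.

End caputo_derivatives.

(** * Construction of a solution *)

Section delayed_solution.
Context (R : realType).
Implicit Types (f g X W : R -> R) (M t : R).

(** [X] is the solution with its history and [x] its causal part. The convolved equation for [x]
    contains no derivative, so it can be Laplace transformed directly. *)
Lemma solution_exists alpha a b c tau : 0 < alpha < 1 -> c != 0 -> b != 0 -> 0 < tau ->
  exists X x F : R -> R, exists2 M, 0 < M &
  [/\ is_solution alpha a b c tau X 0 X, causal M x, forall t, 0 <= t -> X t = x t,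
      forall t, c * x t + conv (kap alpha) x t =
        conv (kap (2 * alpha)) (fun t => a * x t + b * x (t - tau) + F t) t &
      [/\ forall M, 0 < M -> causal M F, forall t, 0 <= F t & 0 < F (tau / 2)]].
Proof.
move=> /andP[al0 al1] c0 b0 tau0.
have q0 : 0 < 2 - 2 * alpha by lra.
have q1 : 2 - 2 * alpha + alpha = 2 - alpha by ring.
have q2 : 2 - 2 * alpha + 2 * alpha = 2 by ring.
have lin_eq (x1 x2 x3 x4 x5 x6 y1 y2 y3 : R) : x1 = y1 -> x2 = y2 -> c * y2 + y1 = x3 ->
    x3 = x4 -> x4 = a * x5 + b * x6 + y3 -> x1 + c * x2 = a * x5 + b * (b^-1 * y3 + x6).
  by move=> -> -> h1 h2 h3; rewrite mulrDr mulrA mulfV// mul1r; lra.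
have [F [F1 [F2 [dF dF1 Fout [F_ge0 F_gt0 cF2]]]]] := bump_exists tau0.
have al20 : 0 < 2 * alpha by rewrite mulr_gt0.
have [M M0 [U cU eU]] := delayed_volterra_existence a b al0 c0 (ltW tau0) cF2.
have p1 : 0 < 1 :> R by [].
have p2 : 0 < 2 :> R by [].
have p11 : 1 + 1 = 2 :> R by [].
have F10 : F1 0 = 0 by have [] // := Fout 0; rewrite lexx.
have F00 : F 0 = 0 by have [] // := Fout 0; rewrite lexx.
(* Two integrations from 0 recover [F] from [F2], and this transfers causality at every rate to
   [F]. *)
have FE1 M' : 0 < M' -> F = conv (kap 2) F2.
  move=> M'0; have cF1 : causal M' F1.
    rewrite (causal_primitive M'0 (cF2 M' M'0) dF1 F10).
    exact: causal_conv_kap (cF2 M' M'0).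
  rewrite (causal_primitive M'0 cF1 dF F00).
  rewrite (causal_primitive M'0 (cF2 M' M'0) dF1 F10).
  exact: (conv_kap_add p11 p1 p1 M'0 (cF2 M' M'0)).
have cF M' : 0 < M' -> causal M' F.
  by move=> M'0; rewrite (FE1 M' M'0); exact: causal_conv_kap (cF2 M' M'0).
have FE := FE1 M M0.
pose V := conv (kap 1) U; pose x := conv (kap 2) U.
have cV : causal M V by exact: causal_conv_kap.
have cx : causal M x by exact: causal_conv_kap.
have xE : x = conv (kap 1) V by exact: (esym (conv_kap_add p11 p1 p1 M0 cU)).
have dV (t : R) : is_derive t 1 V (U t) by exact: (is_derive_conv_kap1 t M0 cU).
have dx (t : R) : is_derive t 1 x (V t) by rewrite xE; exact: (is_derive_conv_kap1 t M0 cV).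
pose rhs f g t := a * f t + b * f (t - tau) + g t.
have crhs f g : causal M f -> causal M g -> causal M (rhs f g).
  move=> cf cg; apply: causalD => //; apply: causalD; first exact: causalZ.
  by apply: causalZ; apply: causal_delay => //; exact: ltW.
have conv_rhs p f g : 0 < p -> causal M f -> causal M g ->
    conv (kap p) (rhs f g) = rhs (conv (kap p) f) (conv (kap p) g).
  move=> p0 cf cg; apply/funext => t.
  have cfd : causal M (fun t => f (t - tau)) by apply: causal_delay => //; exact: ltW.
  have e1 := conv_kapD t p0 M0 (causalD (causalZ a cf) (causalZ b cfd)) cg.
  have e2 := conv_kapD t p0 M0 (causalZ a cf) (causalZ b cfd).
  have e3 := conv_kapZ a t p0 M0 cf.
  have e4 := conv_kapZ b t p0 M0 cfd.
  have e5 := conv_delay (kap p) f tau t.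
  have lin (x1 x2 x3 x4 x5 x6 x7 : R) : x1 = x2 + x3 -> x2 = x4 + x5 ->
    x4 = a * x6 -> x5 = b * x7 -> x1 = a * x6 + b * x7 + x3 by move=> -> -> -> ->.
  rewrite /rhs -e5; exact: lin e1 e2 e3 e4.
have eqU : (fun t => c * U t + conv (kap alpha) U t) = conv (kap (2 * alpha)) (rhs U F2).
  by apply/funext => t; exact: eU.
(* Convolving the Volterra equation with [kap p]: the choice 2 - 2 alpha will give the delay
   equation, the choice 2 the equation for [x]. *)
have eq_conv p : 0 < p -> forall t, c * conv (kap p) U t + conv (kap (p + alpha)) U t =
    conv (kap (p + 2 * alpha)) (rhs U F2) t.
  move=> p0 t.
  have e0 := congr1 (fun f => f t)
    (conv_kap_kap_causal p0 al20 M0 (crhs _ _ cU (cF2 M M0))).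
  have {}e0 := etrans (congr1 (fun f => conv (kap p) f t) eqU) e0.
  have cal : causal M (conv (kap alpha) U) by exact: causal_conv_kap.
  have e1 := conv_kapD t p0 M0 (causalZ c cU) cal.
  have e2 := conv_kapZ c t p0 M0 cU.
  have e3 := congr1 (fun f => f t) (conv_kap_kap_causal p0 al0 M0 cU).
  have lin (x1 x2 x3 x4 x5 : R) : x1 = x2 + x3 -> x2 = c * x4 -> x3 = x5 ->
    c * x4 + x5 = x1 by move=> -> -> ->.
  exact: etrans (lin _ _ _ _ _ e1 e2 e3) e0.
(* [F] vanishes outside [[0, tau]], so the first term lives on the history
   only, while [b * X (t - tau) = F t + b * x (t - tau)]. *)
pose X t := b^-1 * F (t + tau) + x t.
have dshift f (t d : R) : is_derive (t + tau) 1 f d ->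
    is_derive t 1 (fun s => f (s + tau)) d.
  move=> df; rewrite -(mulr1 d).
  have dg : is_derive t 1 (fun s : R => s + tau) 1.
    have d1 : is_derive t 1 (cst tau : R -> R) 0 by exact: is_derive_cst.
    have d2 : is_derive t 1 (@id R) 1 by exact: is_derive_id.
    by apply: (is_derive_eq (is_deriveD d2 d1)); rewrite addr0.
  exact: (@is_derive1_comp R f (fun s => s + tau) t d 1 df dg).
pose X1 t := b^-1 * F1 (t + tau) + V t.
pose X2 t := b^-1 * F2 (t + tau) + U t.
have dX (t : R) : is_derive t 1 X (X1 t).
  exact: (is_derive_eq (is_deriveD (is_deriveZ b^-1 (dshift F t _ (dF _))) (dx t))).
have dX1 (t : R) : is_derive t 1 X1 (X2 t).
  exact: (is_derive_eq (is_deriveD (is_deriveZ b^-1 (dshift F1 t _ (dF1 _))) (dV t))).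
have X_E : derive1 X = X1.
  by apply/funext => t; rewrite derive1E; have [] := dX t.
have X1_E : derive1 X1 = X2.
  by apply/funext => t; rewrite derive1E; have [] := dX1 t.
have Fpos t : 0 <= t -> [/\ X t = x t, X1 t = V t & X2 t = U t].
  move=> t0; have [|h1 h2 h3] := Fout (t + tau); first by rewrite lerDr t0 orbT.
  have lin (u z : R) : u = 0 -> b^-1 * u + z = z by move=> ->; rewrite mulr0 add0r.
  by split; [exact: lin h1|exact: lin h2|exact: lin h3].
have Xx t : 0 <= t -> X t = x t by move=> t0; have [h _ _] := Fpos t t0.
have cont_of (f df : R -> R) : (forall t, is_derive t 1 f (df t)) -> continuous f.
  move=> fdf t; apply: differentiable_continuous; apply/derivable1_diffP.
  by have [] := fdf t.
have cX := cont_of _ _ dX; have cX1 := cont_of _ _ dX1.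
have cX2 : continuous X2.
  have [cF2' _ _] := cF2 M M0; have [cU' _ _] := cU.
  have cF2s : continuous (fun t => b^-1 * F2 (t - - tau)) := continuousZ_shift cF2'.
  have E : X2 = (fun t => b^-1 * F2 (t - - tau) + U t).
    by apply/funext => s; rewrite /X2 opprK.
  by rewrite E => t; exact: (continuousD (cF2s t) (cU' t)).
have deriv_X t : derivable X t 1 by have [] := dX t.
have nat01 (r : R) n : n%:R < r < n.+1%:R -> Num.truncn r = n /\ r \isn't a Num.nat.
  move=> /andP[nr rn]; have tn : Num.truncn r = n by apply: truncn_def; rewrite ltW.
  by split=> //; rewrite natrEtruncn tn lt_eqF.
(* For order below 1 the Caputo derivative is [kap (1 - r)] convolved with [V], and [V] is the
   convolution of [kap 1] with [U]; the orders of the kernels add. *)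
have order0 (r : R) : 0 < r < 1 -> forall t, 0 < t ->
    caputo_derivable r X t /\ caputo r X t = conv (kap (2 - r)) U t.
  move=> r01 t t0; have [tn nn] := nat01 r 0%N r01.
  have /andP[r0 r1] := r01.
  have XV s : 0 <= s -> derive1n (caputo_order r) X s = V s.
    by move=> s0; rewrite /caputo_order tn /derive1n/= X_E; have [_ h _] := Fpos s s0.
  have [i1 i2] := caputo_conv t M0 nn (ltW r0) cV XV.
  split.
    rewrite /caputo_derivable (negbTE nn); split => //.
    - by rewrite /caputo_order tn.
    - rewrite /caputo_order tn/=; exact: abs_continuous_on_C1 (ltW t0) dX cX1.
  rewrite i2; have p3 : 0 < (caputo_order r)%:R - r by rewrite /caputo_order tn subr_gt0.
  have e : (caputo_order r)%:R - r + 1 = 2 - r by rewrite /caputo_order tn addrAC.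
  exact: (congr1 (fun f => f t) (conv_kap_add e p3 p1 M0 cU)).
have order1 (r : R) : 1 < r < 2 -> forall t, 0 < t ->
    caputo_derivable r X t /\ caputo r X t = conv (kap (2 - r)) U t.
  move=> r01 t t0; have [tn nn] := nat01 r 1%N r01.
  have /andP[r0 r1] := r01.
  have XU s : 0 <= s -> derive1n (caputo_order r) X s = U s.
    by move=> s0; rewrite /caputo_order tn /derive1n/= X_E X1_E; have [_ _ h] := Fpos s s0.
  have [i1 i2] := caputo_conv t M0 nn (ltW (lt_trans p1 r0)) cU XU.
  have e : (caputo_order r)%:R - r = 2 - r by rewrite /caputo_order tn.
  split; last by rewrite e in i2.
  rewrite /caputo_derivable (negbTE nn); split => //.
  - by rewrite /caputo_order tn => -[|[|k]]// _ s _; exact: deriv_X.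
  - rewrite /caputo_order tn /derive1n/= X_E; exact: abs_continuous_on_C1 (ltW t0) dX1 cX2.
(* The order 2 alpha may lie on either side of 1; at 1 the Caputo derivative is the ordinary one,
   and the same formula holds. *)
have order_al2 t : 0 < t -> caputo_derivable (2 * alpha) X t /\
    caputo (2 * alpha) X t = conv (kap (2 - 2 * alpha)) U t.
  move=> t0; have [lt1|lt1|e1] := ltgtP (2 * alpha) 1.
  - by apply: order0 => //; rewrite al20.
  - by apply: order1 => //; rewrite lt1/=; lra.
  - rewrite e1 /caputo_derivable /caputo nat_num1 truncn1; split.
      by case=> // _ s _; exact: deriv_X.
    rewrite /derive1n/= X_E; have [_ -> _] := Fpos t (ltW t0).
    by rewrite /V; congr (conv (kap _) U t); lra.
have sol : is_solution alpha a b c tau X 0 X.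
  split.
  - exact: (continuous_subspaceT cX).
  - by move=> t _.
  (* The slope at 0 is zero, since [F1] vanishes at [tau] and [V] at 0. *)
  - move=> _; have [ex0 val0] := dX 0.
    have X10 : X1 0 = 0.
      by have [_ -> _] := Fpos 0 (lexx 0); have [_ V0 _] := cV; exact: V0.
    have lim0 : h^-1 *: (X (h *: 1 + 0) - X 0) @[h --> 0^'] --> (X1 0 : R).
      by rewrite -[X in _ --> X]val0; exact: ex0.
    rewrite X10 in lim0.
    have := cvg_dnbhs_at_right lim0; apply: cvg_trans; apply: near_eq_cvg.
    by near=> h; rewrite addr0 /GRing.scale/= mulr1.
  - move=> t t0; have [d1 c1] := order0 alpha (introT andP (conj al0 al1)) t t0.
    have [d2 c2] := order_al2 t t0; split; [exact: d1|exact: d2|].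
    have e3 := eq_conv _ q0 t; rewrite q1 q2 in e3.
    have e4 := congr1 (fun f => f t) (conv_rhs 2 U F2 p2 cU (cF2 M M0)).
    have e5 : X (t - tau) = b^-1 * F t + x (t - tau) by rewrite /X subrK.
    have e6 : rhs (conv (kap 2) U) (conv (kap 2) F2) t = a * x t + b * x (t - tau) + F t.
      by rewrite /rhs -FE.
    rewrite (Xx t (ltW t0)) e5; exact: (lin_eq _ _ _ _ _ _ _ _ _ c1 c2 e3 e4 e6).
exists X, x, F, M; first exact: M0.
split; [exact: sol|exact: cx|exact: Xx| |split; [exact: cF|exact: F_ge0|exact: F_gt0]].
move=> t.
have e1 := conv_kap_add (addrC (2 * alpha) 2) al20 p2 M0 (crhs _ _ cU (cF2 M M0)).
have e2 := conv_kap_add (addrC alpha 2) al0 p2 M0 cU.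
have e3 := conv_rhs 2 U F2 p2 cU (cF2 M M0).
rewrite -FE in e3; have e4 := eq_conv 2 p2 t.
have lin (x1 x2 x3 x4 x5 : R) : x1 = x2 -> c * x3 + x2 = x4 -> x5 = x4 -> c * x3 + x1 = x5.
  by move=> -> -> ->.
apply: lin (congr1 (fun f => f t) e2) e4 _.
exact: (congr1 (fun f => f t) (etrans (congr1 (conv (kap (2 * alpha))) (esym e3)) e1)).
Unshelve. all: by end_near. Qed.

End delayed_solution.

(** * Instability *)

Section instability.
Context (R : realType).
Local Notation mu := (@lebesgue_measure R).
Implicit Types (f : R -> R) (M L t : R).

(* Intermediate value theorem in the variable [y = l `^ alpha], between the
   vertex [-1 / (2 * c)] of [y + c * y ^+ 2] and a large [y]. *)
Lemma characteristic_root (alpha a b c tau : R) : 0 < alpha -> c < 0 -> 0 < b ->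
  a < -1 / (4 * c) ->
  - ln ((-1 - 4 * a * c) / (4 * b * c)) / (-1 / (2 * c)) `^ (1 / alpha) < tau ->
  exists2 l, 0 < l & l `^ alpha + c * l `^ (2 * alpha) = a + b * expR (- (l * tau)).
Proof.
move=> al0 c0 b0 ha htau.
have lin (p q r s : R) : p + q - r - s = 0 -> p + q = r + s by move=> h; lra.
have cn0 : c != 0 by rewrite lt_eqF.
have bn0 : b != 0 by rewrite gt_eqF.
pose G y := y + c * y ^+ 2 - a - b * expR (- (y `^ (1 / alpha) * tau)).
pose y0 := -1 / (2 * c).
have y00 : 0 < y0 by rewrite /y0 mulN1r oppr_gt0 invr_lt0; lra.
pose C := - c; have C0 : 0 < C by rewrite oppr_gt0.
(* Chosen so that C Y = C + 1 + |a|; then c Y^2 outweighs Y - a and [G Y] is negative. *)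
pose Y := 1 + (1 + `|a|) / C.
have na := normr_ge0 a.
have Y1 : 1 <= Y by rewrite lerDl divr_ge0 ?(ltW C0)//; lra.
have y0Y : y0 <= Y.
  have e1 : y0 = 2^-1 * C^-1 by rewrite /y0 /C; field.
  have e2 : 0 <= `|a| * C^-1 by rewrite mulr_ge0// invr_ge0 ltW.
  have e3 : 0 < C^-1 by rewrite invr_gt0.
  rewrite e1 /Y mulrDl mul1r; lra.
(* At the vertex y + c y^2 equals -1 / (4 c), and the lower bound on [tau] says exactly that the
   exponential term is below this value minus [a]. *)
have Gy0 : 0 < G y0.
  have r0 : 0 < (-1 - 4 * a * c) / (4 * b * c).
    have h1 : 4 * b * c < 0 by rewrite nmulr_llt0// mulr_gt0.
    rewrite -mulrNN -invrN divr_gt0 ?oppr_gt0//.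
    move: ha; rewrite ltr_ndivlMr; [lra|lra].
  have l0 : 0 < y0 `^ (1 / alpha) by rewrite powR_gt0.
  have : expR (- (y0 `^ (1 / alpha) * tau)) < (-1 - 4 * a * c) / (4 * b * c).
    by rewrite -[ltRHS]lnK ?posrE// ltr_expR ltrNl (mulrC _ tau) -ltr_pdivrMr.
  rewrite -(ltr_pM2l b0) => h.
  have e1 : b * ((-1 - 4 * a * c) / (4 * b * c)) = y0 + c * y0 ^+ 2 - a.
    by rewrite /y0; field; rewrite cn0 bn0.
  by rewrite /G -e1 subr_gt0.
have GY : G Y < 0.
  have h1 : C * Y = C + 1 + `|a| by rewrite /Y mulrDr mulr1 mulrCA mulfV ?mulr1 ?addrA// gt_eqF.
  have h2 : c * Y ^+ 2 = - ((C + 1 + `|a|) * Y) by rewrite -h1 /C expr2; ring.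
  have h3 : `|a| <= `|a| * Y by rewrite ler_peMr.
  have h4 : 0 < C * Y by rewrite mulr_gt0//; lra.
  have h5 : 0 < b * expR (- (Y `^ (1 / alpha) * tau)) by rewrite mulr_gt0 ?expR_gt0.
  have h6 := ler_norm (- a); rewrite normrN in h6.
  rewrite /G h2 !mulrDl mul1r; lra.
have cG : {within `[y0, Y], continuous G}.
  apply: continuous_in_subspaceT => y; rewrite inE/= in_itv/= => /andP[yy _].
  have yp : 0 < y by rewrite (lt_le_trans y00).
  have cp : {for y, continuous (fun x : R => x `^ (1 / alpha))}.
    apply/differentiable_continuous/derivable1_diffP.
    by apply: derivable_powR; rewrite in_itv/= yp.
  have e1 : {for y, continuous (fun x : R => expR (- (x `^ (1 / alpha) * tau)))}.
    apply: (@continuous_comp _ _ _ (fun x : R => - (x `^ (1 / alpha) * tau)) expR).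
      by apply: continuousN; apply: continuousM; [exact: cp|exact: cst_continuous].
    exact: continuous_expR.
  apply: cvgB; last by apply: cvgM; [exact: cvg_cst|exact: e1].
  apply: cvgB; last exact: cvg_cst.
  apply: cvgD; first exact: cvg_id.
  apply: cvgM; [exact: cvg_cst|exact: exprn_continuous].
have [|y] := @IVT R G y0 Y 0 y0Y cG.
  move: (G y0) (G Y) Gy0 GY => u v u0 v0.
  by rewrite ge_min le_max (ltW u0) (ltW v0) orbT.
rewrite in_itv/= => /andP[yy _] Gy.
have yp : 0 < y by rewrite (lt_le_trans y00).
exists (y `^ (1 / alpha)); first exact: powR_gt0.
rewrite -!powRrM div1r mulVf ?gt_eqF// powRr1 ?(ltW yp)// mulrCA mulVf ?gt_eqF//.
rewrite mulr1 powR_mulrn ?(ltW yp)//.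
rewrite /G div1r in Gy; exact: lin Gy.
Qed.

(** By continuity the integrand stays above half its value at [t] on an interval of positive
    length. *)
Lemma laplace_gt0 L M f t : M < L -> causal M f -> (forall s, 0 <= f s) ->
  0 < f t -> 0 < laplace L f.
Proof.
move=> ML cf f0 ft0; have [ctf _ _] := cf.
pose h s := expR (- (L * s)) * f s.
have h0 s : 0 <= h s by rewrite mulr_ge0 ?expR_ge0.
have ht : 0 < h t by rewrite mulr_gt0 ?expR_gt0.
have ch : continuous h.
  move=> s; apply: cvgM; last exact: ctf.
  apply: (@continuous_comp _ _ _ (fun s : R => - (L * s)) expR).
    by apply: continuousN; apply: continuousM; [exact: cst_continuous|exact: cvg_id].
  exact: continuous_expR.
have ih := integrable_laplace ML cf.
pose d := h t / 2; have d0 : 0 < d by rewrite divr_gt0.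
have /cvgrPdist_lt/(_ _ d0) [r /= r0 hr] := ch t.
have hd s : s \in `]t - r, t + r[ -> d <= h s.
  rewrite in_itv/= => /andP[s1 s2]; have := hr s.
  rewrite /ball_/= => /(_ _); rewrite ltr_distlC s1 s2 => /(_ isT).
  rewrite ltr_distlC /d => /andP[+ _]; lra.
rewrite -lte_fin /laplace /Rintegral fineK; last exact: integrable_fin_num.
pose D : set R := `]t - r, t + r[%classic.
apply: (@lt_le_trans _ _ (\int[mu]_(s in D) d%:E)%E).
  rewrite integral_cst; last exact: measurable_itv.
  rewrite [X in (_ * X)%E]lebesgue_measure_itv/= lte_fin ifT; last lra.
  by rewrite -EFinB -EFinM lte_fin mulr_gt0//; lra.
apply: (@le_trans _ _ (\int[mu]_(s in D) (h s)%:E)%E).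
  apply: ge0_le_integral.
  - exact: measurable_itv.
  - by move=> s _; rewrite lee_fin ltW.
  - exact: measurable_cst.
  - by apply: measurable_funTS; exact: measurable_int ih.
  - by move=> s /= ss; rewrite lee_fin hd.
apply: ge0_subset_integral => //.
- exact: measurable_itv.
- exact: measurable_int ih.
- by move=> s _; rewrite lee_fin.
Qed.

(** The exponential bound controls [f] up to [A] and [K] controls it afterwards, so [f] is bounded
    on the whole line. The growth rate can then be lowered below the root [l]. *)
Lemma causal_bounded_near f M : 0 < M -> causal M f ->
  (exists A K : R, forall t, A < t -> `|f t| <= K) -> forall M', 0 < M' -> causal M' f.
Proof.
move=> M0 [cf f0 [B fB]] [A [K fK]] M' M'0; split => //.
exists (`|K| + `|B| * expR (M * `|A|)) => t.
have B0 : 0 <= `|B| * expR (M * `|A|) by rewrite mulr_ge0 ?expR_ge0.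
have [t0|t0] := leP t 0.
  by rewrite f0// normr0 mulr_ge0 ?expR_ge0// addr_ge0.
apply: (@le_trans _ _ (`|K| + `|B| * expR (M * `|A|))); last first.
  by rewrite ler_peMr ?addr_ge0// -expR0 ler_expR mulr_ge0 ?ltW.
have [At|tA] := ltP A t.
  by rewrite (le_trans (fK _ At))// (le_trans (ler_norm _))// lerDl.
rewrite (le_trans (fB _))// (@le_trans _ _ (`|B| * expR (M * `|A|))) ?lerDr//.
apply: ler_pM; rewrite ?expR_ge0 ?ler_norm//.
- by have := le_trans (normr_ge0 _) (fB 0); rewrite mulr0 expR0 mulr1.
- by rewrite ler_expR ler_wpM2l ?(ltW M0)// (le_trans tA)// ler_norm.
Qed.

Lemma real_root_unstable (alpha a b c tau l : R) :
  0 < alpha < 1 -> c != 0 -> b != 0 -> 0 < tau -> 0 < l ->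
  l `^ alpha + c * l `^ (2 * alpha) = a + b * expR (- (l * tau)) ->
  unstable alpha a b c tau.
Proof.
move=> al01 c0 b0 tau0 l0 root st.
have /andP[al0 _] := al01.
have al20 : 0 < 2 * alpha by rewrite mulr_gt0.
have [X [x [F [M M0 [solX cx Xx eqx [cF F0 Fpos]]]]]] := solution_exists a al01 c0 b0 tau0.
have [A [K xK]] : exists A K : R, forall t, A < t -> `|x t| <= K.
  have [K [_ HK]] := st _ _ _ solX.
  have K1 : K < K + 1 by rewrite ltrDl.
  have [A [_ HA]] := HK _ K1.
  exists (Num.max A 0), (K + 1) => t; rewrite gt_max => /andP[At t0].
  by rewrite -(Xx t (ltW t0)); exact: (HA t At).
(* A rate strictly between 0 and [l], so that every transform at [l] converges. *)
pose M1 := l / 2.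
have M10 : 0 < M1 by rewrite divr_gt0.
have M1l : M1 < l by rewrite /M1; lra.
have {}cx := causal_bounded_near M0 cx (ex_intro _ A (ex_intro _ K xK)) M10.
have {}cF := cF _ M10.
have cxd : causal M1 (fun t => x (t - tau)) by apply: causal_delay => //; exact: ltW.
have cax := causalZ a cx; have cbx := causalZ b cxd; have caxb := causalD cax cbx.
have crhs := causalD caxb cF.
have E : laplace l (fun t => c * x t + conv (kap alpha) x t) =
  laplace l (conv (kap (2 * alpha)) (fun t => a * x t + b * x (t - tau) + F t)).
  by congr laplace; apply/funext => t; exact: eqx.
have cka := causal_conv_kap al0 M10 cx.
rewrite (laplaceD M1l (causalZ c cx) cka) (laplaceZ c M1l cx) in E.
rewrite (laplace_conv_kap al0 M10 M1l cx) (laplace_conv_kap al20 M10 M1l crhs) in E.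
rewrite (laplaceD M1l caxb cF) (laplaceD M1l cax cbx) in E.
rewrite (laplaceZ a M1l cx) (laplaceZ b M1l cxd) (laplace_delay tau M1l cx) in E.
have LF := laplace_gt0 M1l cF F0 Fpos.
have pa : l `^ alpha != 0 by rewrite gt_eqF// powR_gt0.
have e2 : l `^ (2 * alpha) = l `^ alpha * l `^ alpha.
  rewrite -powRD; last by rewrite (gt_eqF l0) implybT.
  by congr (_ `^ _); ring.
rewrite !powRN e2 in E; rewrite e2 in root.
(* With p = l^alpha and e = exp(-l tau), multiplying by p^2 gives (p + c p^2 - a - b e) u = v for
   the transforms u of [x] and v of [F]; the characteristic equation makes the bracket vanish. *)
suff : laplace l F = 0 by move=> L0; rewrite L0 ltxx in LF.
move: E root pa; clear.
move: (laplace l x) (laplace l F) (l `^ alpha) (expR (- (l * tau))) => u v p e E root p0.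
have {}E : c * p * p * u + p * u = a * u + b * (e * u) + v.
  have pp0 : p * p != 0 by rewrite mulf_neq0.
  by rewrite -[RHS](mulVKf pp0) -E; field; rewrite p0.
have -> : v = (p + c * (p * p) - (a + b * e)) * u by lra.
by rewrite root subrr mul0r.
Qed.
End instability.

(** * The critical delay *)

Unset Implicit Arguments.

Theorem theoremV4 (R : realType) (alpha a b c : R)
    (halpha : 0 < alpha < 1)
    (hc : c < 0) (hb : 0 < b) (hab : - b < a)
    (ha : -1 / (4 * c) - b < a < -1 / (4 * c)) :
  exists tau_star : R,
    tau_star = - ln ((-1 - 4 * a * c) / (4 * b * c))
                 / (-1 / (2 * c)) `^ (1 / alpha)
    /\ forall tau : R, tau_star < tau -> unstable alpha a b c tau.
Proof.
eexists; split; first by [].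
move=> tau htau; have /andP[al0 _] := halpha.
have [l l0 root] := characteristic_root al0 hc hb (proj2 (andP ha)) htau.
(* The lower bound -1 / (4 c) - b on [a] keeps the argument of the logarithm at most 1, so the
   critical delay is nonnegative; a positive [tau] leaves room for the bump in the history. *)
have tau0 : 0 < tau.
  apply: le_lt_trans htau; rewrite divr_ge0 ?powR_ge0// oppr_ge0 ln_le0//.
  have h1 : 4 * b * c < 0 by rewrite nmulr_llt0// mulr_gt0.
  rewrite ler_ndivrMr// mul1r; case/andP: ha => h2 _.
  have : a * (4 * c) < (-1 / (4 * c) - b) * (4 * c) by rewrite ltr_nM2r//; lra.
  rewrite mulrBl divfK; last by rewrite mulf_neq0// lt_eqF.
  lra.
exact: (real_root_unstable halpha (ltr0_neq0 hc) (lt0r_neq0 hb) tau0 l0 root).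
Qed.
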